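(* Let $p,Q$ be real-valued measurable functions on the finite interval $\mathcal J=(a,b)$ with $1/p,\ Q/p,\ Q^2/p\in L_1(\mathcal J)$, and let $L_{\min}$ and, for operators $K$ on $\mathbb C^2$, $L_K$ be the operators on $L_2(\mathcal J,\mathbb C)$ defined in the context. Every $L_K$ with $K$ a unitary operator on $\mathbb C^2$ is a self-adjoint extension of $L_{\min}$. Conversely, for any self-adjoint extension $\widetilde L$ of $L_{\min}$ (in $L_2(\mathcal J,\mathbb C)$) there is a unitary operator $K$ on $\mathbb C^2$ such that $\widetilde L=L_K$. This correspondence between unitary operators $K$ on $\mathbb C^2$ and self-adjoint extensions $\widetilde L$ of $L_{\min}$ is bijective.
   Context: Let $\mathcal J=(a,b)$ be a finite interval and $L_2=L_2(\mathcal J,\mathbb C)$; $p$ is finite and nonzero a.e. The formal expression $-(py')'+qy$ with $q=Q'$ (distributional derivative) is interpreted through the quasi-derivatives $$D^{[0]}y=y,\qquad D^{[1]}y=py'-Qy,\qquad D^{[2]}y=(D^{[1]}y)'+\frac Qp D^{[1]}y+\frac{Q^2}{p}y$$ as $l[y]:=-D^{[2]}y$. The maximal operator is $L_{\max}y=l[y]$ with $\operatorname{Dom}(L_{\max})=\{y\in L_2:\ y,D^{[1]}y\in AC([a,b],\mathbb C),\ D^{[2]}y\in L_2\}$; the minimal operator $L_{\min}$ is the restriction of $L_{\max}$ to $\{y\in\operatorname{Dom}(L_{\max}):\ D^{[k]}y(a)=D^{[k]}y(b)=0,\ k=0,1\}$. Define $\Gamma_1,\Gamma_2:\operatorname{Dom}(L_{\max})\to\mathbb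 C^2$ by $$\Gamma_1y=(D^{[1]}y(a),-D^{[1]}y(b)),\qquad \Gamma_2y=(y(a),y(b)).$$ For a linear operator $K$ on $\mathbb C^2$, $L_K$ denotes the restriction of $L_{\max}$ to the set of $y\in\operatorname{Dom}(L_{\max})$ satisfying $$(K-I)\Gamma_1y+i(K+I)\Gamma_2y=0.$$ *)

(* Defs.v *)
From HB Require Import structures.
From mathcomp Require Import all_boot all_order all_algebra.
From mathcomp Require Import complex ring.
From mathcomp Require Import all_classical all_reals all_analysis.
From mathcomp Require Import measurable_realfun.

Set Implicit Arguments.
Unset Strict Implicit.
Unset Printing Implicit Defensive.

Import Order.TTheory GRing.Theory Num.Theory.
Import numFieldNormedType.Exports.
Import ComplexField.

Local Open Scope classical_set_scope.
Local Open Scope ring_scope.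
Local Open Scope quotient_scope.

Section L2_space.
Variables (R : realType) (a b : R).
Local Notation C := R[i].
Local Notation re := (@complex.Re R).
Local Notation im := (@complex.Im R).
Local Notation mu := (@lebesgue_measure R).
Local Notation J := (`]a, b[%classic : set R).

(* Borel representatives suffice: every Lebesgue measurable function agrees
   almost everywhere with a Borel measurable one. *)
Definition square_integrable : {pred R -> C} := fun f => `[<
  [/\ measurable_fun J (re \o f),
      measurable_fun J (im \o f) &
      (\int[mu]_(x in J) ((Normc.normc (f x)) ^+ 2)%:E < +oo)%E] >].

Fact sqnormc (z : C) :
  Normc.normc z ^+ 2 = re z ^+ 2 + im z ^+ 2.
Proof.
by case: z => x y /=; rewrite sqr_sqrtr// addr_ge0// sqr_ge0.
Qed.

Fact measurable_sqnormc (f : R -> C) :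
  measurable_fun J (re \o f) -> measurable_fun J (im \o f) ->
  measurable_fun J (fun x => (Normc.normc (f x) ^+ 2)%:E).
Proof.
move=> mr mi; apply/measurable_EFinP.
rewrite (_ : (fun x => _) = (fun x => ((re \o f) x) ^+ 2 +
  ((im \o f) x) ^+ 2)); last first.
  by apply/funext => x; rewrite sqnormc.
by apply: measurable_funD; apply: measurable_funX.
Qed.

Fact square_integrable_submod_closed : submod_closed square_integrable.
Proof.
split=> [|c f g].
  apply/asboolP; split; [exact: measurable_cst|exact: measurable_cst|].
  rewrite integral0_eq ?ltry// => x _.
  by rewrite sqnormc /= expr0n /= addr0.
move=> /asboolP[mrf mif finf] /asboolP[mrg mig fing].
have mr : measurable_fun J (re \o (c *: f + g)).
  rewrite (_ : _ \o _ = fun x => re c * (re \o f) x -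
    im c * (im \o f) x + (re \o g) x); last first.
    apply/funext => x /=; rewrite !fctE /=.
    by case: (c) (f x) (g x) => [? ?] [? ?] [? ?].
  apply: measurable_funD => //; apply: measurable_funB;
    by apply: measurable_funM.
have mi : measurable_fun J (im \o (c *: f + g)).
  rewrite (_ : _ \o _ = fun x => re c * (im \o f) x +
    im c * (re \o f) x + (im \o g) x); last first.
    apply/funext => x /=; rewrite !fctE /=.
    by case: (c) (f x) (g x) => [? ?] [? ?] [? ?] /=; congr (_ + _).
  apply: measurable_funD => //; apply: measurable_funD;
    by apply: measurable_funM.
apply/asboolP; split => //.
pose k : R := 2 * Normc.normc c ^+ 2.
have k0 : 0 <= k by rewrite mulr_ge0// sqr_ge0.
apply: (@le_lt_trans _ _ (\int[mu]_(x in J)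
  (k%:E * (Normc.normc (f x) ^+ 2)%:E + 2%:E * (Normc.normc (g x) ^+ 2)%:E))%E).
  apply: ge0_le_integral => //.
  - by move=> x _; rewrite lee_fin sqr_ge0.
  - exact: measurable_sqnormc.
  - by apply: emeasurable_funD; apply: measurable_funeM;
      apply: measurable_sqnormc.
  move=> x _; rewrite -!EFinM -EFinD lee_fin /k !fctE.
  have -> : (c *: f x + g x) = c * f x + g x by [].
  rewrite -mulrA -exprMn -Normc.normcM; set u := c * f x; set v := g x.
  rewrite !sqnormc -subr_ge0.
  rewrite (_ : _ - _ = (re u - re v) ^+ 2 +
    (im u - im v) ^+ 2); last first.
    by case: u v => [? ?] [? ?] /=; ring.
  by rewrite addr_ge0// sqr_ge0.
rewrite ge0_integralD//=.
- rewrite !ge0_integralZl//; try exact: measurable_sqnormc;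
    try by move=> *; rewrite lee_fin sqr_ge0.
  by rewrite lte_add_pinfty// lte_mul_pinfty//.
- by move=> x _; rewrite -EFinM lee_fin mulr_ge0 ?sqr_ge0.
- by apply: measurable_funeM; apply: measurable_sqnormc.
- by move=> x _; rewrite -EFinM lee_fin mulr_ge0 ?sqr_ge0.
- by apply: measurable_funeM; apply: measurable_sqnormc.
Qed.

HB.instance Definition _ :=
  GRing.isSubmodClosed.Build C (R -> C) square_integrable
    square_integrable_submod_closed.

Record L2fun := MkL2fun {
  L2fun_val :> R -> C;
  L2funP : L2fun_val \in square_integrable }.

HB.instance Definition _ := [isSub for L2fun_val].
HB.instance Definition _ := [Choice of L2fun by <:].
HB.instance Definition _ := [SubChoice_isSubLmodule of L2fun by <:].

Definition null_fun : {pred L2fun} :=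
  fun f => `[< \forall x \ae mu, J x -> f x = 0 >].

Fact null_fun_zmod_closed : zmod_closed null_fun.
Proof.
split=> [|f g /asboolP f0 /asboolP g0]; apply/asboolP.
  by apply: aeW => x.
apply: (@filterS2 _ _ (ae_filter_ringOfSetsType mu)) f0 g0 => x f0 g0 Jx.
rewrite [LHS]/(f x - g x) f0// g0//; exact: (subrr (0 : C)).
Qed.

HB.instance Definition _ :=
  GRing.isZmodClosed.Build L2fun null_fun null_fun_zmod_closed.

Definition L2 : Type := {ideal_quot null_fun}.

HB.instance Definition _ := GRing.Zmodule.on L2.
HB.instance Definition _ := EqQuotient.on L2.

Definition L2scale (c : C) : L2 -> L2 := lift_op1 L2 ( *:%R c).

Fact pi_L2scale (c : C) : {morph \pi_L2 : f / c *: f >-> L2scale c f}.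
Proof.
move=> f; unlock L2scale; apply/eqP.
rewrite -Quotient.idealrBE -scalerBr; apply/asboolP.
have : (f - repr (\pi_L2 f)) \in null_fun by rewrite Quotient.idealrBE reprK.
move=> /asboolP; apply: (@filterS _ _ (ae_filter_ringOfSetsType mu)) => x fx Jx.
rewrite [LHS]/(c * (f - repr (\pi_L2 f)) x) fx//; exact: (mulr0 (c : C)).
Qed.

Fact L2scaleA c d f : L2scale c (L2scale d f) = L2scale (c * d) f.
Proof. by rewrite -[f]reprK -!pi_L2scale scalerA. Qed.

Fact L2scale1 : left_id 1 L2scale.
Proof. by move=> f; rewrite -[f]reprK -!pi_L2scale scale1r. Qed.

Fact L2scaleDr : right_distributive L2scale +%R.
Proof.
move=> c f g; rewrite -[f]reprK -[g]reprK -!pi_L2scale -!raddfD /=.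
by rewrite -pi_L2scale scalerDr.
Qed.

Fact L2scaleDl f : {morph L2scale^~ f : c d / c + d}.
Proof.
by move=> c d; rewrite -[f]reprK -!pi_L2scale -raddfD scalerDl.
Qed.

HB.instance Definition _ := GRing.Zmodule_isLmodule.Build C L2
  L2scaleA L2scale1 L2scaleDr L2scaleDl.

Definition fun_of_L2 (f : L2) : R -> C := L2fun_val (repr f).
Coercion fun_of_L2 : L2 >-> Funclass.

Definition L2dot (f g : L2) : C :=
  let h x := f x * (g x)^*%C in
  Complex (\int[mu]_(x in J) re (h x)) (\int[mu]_(x in J) im (h x)).

Definition L2norm (f : L2) : R := Num.sqrt (re (L2dot f f)).

End L2_space.

Section unbounded_operators.
Variables (R : realType) (a b : R).
Local Notation H := (L2 a b).

(* Operators in L2 are identified with their graphs [set (f, g) | g = L f];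
   in particular restriction is inclusion of graphs. *)
Definition is_linear_operator (L : set (H * H)) : Prop :=
  [/\ L 0,
      forall (c : R[i]) u v, L u -> L v -> L (c *: u + v) &
      forall f g h, L (f, g) -> L (f, h) -> g = h].

Definition densely_defined (L : set (H * H)) : Prop :=
  forall (f : H) (e : R), 0 < e -> exists2 u, L u & L2norm (f - u.1) < e.

Definition adjoint (L : set (H * H)) : set (H * H) :=
  [set v | forall u, L u -> L2dot u.2 v.1 = L2dot u.1 v.2].

Definition self_adjoint (L : set (H * H)) : Prop :=
  [/\ is_linear_operator L, densely_defined L & adjoint L = L].

Definition self_adjoint_extension (L0 L : set (H * H)) : Prop :=
  L0 `<=` L /\ self_adjoint L.

End unbounded_operators.

Section quasi_derivatives.
Variables (R : realType) (a b : R) (p Q : R -> R).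
Local Notation C := R[i].
Local Notation mu := (@lebesgue_measure R).
Local Notation J := (`]a, b[%classic : set R).
Local Notation H := (L2 a b).

(* The Caratheodory sigma-algebra of the outer measure generated by interval
   length consists of the Lebesgue measurable sets. *)
Definition lebesgue_measurable_fun (f : R -> R) : Prop :=
  @measurable_fun _ _ (caratheodory_type (wlength (@idfun R))^*%mu) R J f.

(* Membership of the almost-everywhere class of f in L_1(J). *)
Definition in_L1 (f : R -> R) : Prop :=
  exists2 g : R -> R, mu.-integrable J (EFin \o g) & f = g %[ae mu in J].

(* Absolute continuity on the closed interval [a, b]; the pairwise
   non-overlapping intervals are [s i, t i]. *)
Definition abs_cont (f : R -> C) : Prop :=
  forall e : R, 0 < e -> exists2 d : R, 0 < d &
    forall (n : nat) (s t : 'I_n -> R),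
      (forall i, [/\ a <= s i, s i <= t i & t i <= b]) ->
      (forall i j, i != j -> t i <= s j \/ t j <= s i) ->
      \sum_(i < n) (t i - s i) < d ->
      \sum_(i < n) Normc.normc (f (t i) - f (s i)) < e.

(* The absolutely continuous representative of f, unique on [a, b]. If there
   is none, then ac_rep f = f, which is not absolutely continuous on [a, b];
   hence abs_cont (ac_rep f) iff f has such a representative. *)
Definition ac_rep (f : R -> C) : R -> C :=
  xget f [set u | abs_cont u /\ u = f %[ae mu in J]].

(* Arbitrary where y is not differentiable, which is a null set whenever y is
   absolutely continuous. *)
Definition cderive (y : R -> C) (x : R) : C :=
  Complex (derive1 (@complex.Re R \o y) x) (derive1 (@complex.Im R \o y) x).

Definition qD0 (y : H) : R -> C := ac_rep y.

Definition qD1 (y : H) : R -> C :=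
  ac_rep (fun x => (p x)%:C%C * cderive (qD0 y) x - (Q x)%:C%C * qD0 y x).

Definition qD2 (y : H) (x : R) : C :=
  cderive (qD1 y) x + (Q x / p x)%:C%C * qD1 y x
  + (Q x ^+ 2 / p x)%:C%C * qD0 y x.

Definition Lmax : set (H * H) :=
  [set u | [/\ abs_cont (qD0 u.1), abs_cont (qD1 u.1) &
               fun_of_L2 u.2 = (fun x => - qD2 u.1 x) %[ae mu in J]]].

Definition Lmin : set (H * H) :=
  [set u | [/\ Lmax u, qD0 u.1 a = 0, qD0 u.1 b = 0,
               qD1 u.1 a = 0 & qD1 u.1 b = 0]].

Definition Gamma1 (y : H) : 'cV[C]_2 :=
  \col_(i < 2) (if i == 0 then qD1 y a else - qD1 y b).

Definition Gamma2 (y : H) : 'cV[C]_2 :=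
  \col_(i < 2) (if i == 0 then qD0 y a else qD0 y b).

Definition LK (K : 'M[C]_2) : set (H * H) :=
  [set u | Lmax u /\
    (K - 1%:M) *m Gamma1 u.1 + 'i%C *: ((K + 1%:M) *m Gamma2 u.1) = 0].

End quasi_derivatives.

(* Main.v *)
(* Absolutely continuous functions are exactly the primitives of integrable ones
   (a monotone one generates a Stieltjes measure dominated by Lebesgue measure,
   hence has a Radon-Nikodym density), so l[y] = f is a first-order linear system
   with integrable coefficients, solvable by Picard iteration with any data at a.
   Green's identity turns symmetry questions into algebra of the boundary values
   (Gamma1 y, Gamma2 y), which fill C^4; since the orthogonal complement of the
   range of Lmin is the two-dimensional kernel of l, the adjoint of Lmin is
   contained in Lmax, and completeness of L_2 then gives the density of Dom Lmin.
   Self-adjoint extensions therefore correspond to subspaces of C^4 that are their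
   own annihilators for the boundary form. In the coordinates
   Gamma1 +- i Gamma2 this form is the difference of two inner products, and these
   subspaces are the graphs of unitary matrices K. *)
Require Import Defs.
From HB Require Import structures.
From mathcomp Require Import all_boot all_order all_algebra.
From mathcomp Require Import complex ring lra.
From mathcomp Require Import all_classical all_reals all_analysis.
From mathcomp Require Import measurable_realfun.

Set Implicit Arguments.
Unset Strict Implicit.
Unset Printing Implicit Defensive.

Import Order.TTheory GRing.Theory Num.Theory.
Import numFieldNormedType.Exports.
Import ComplexField.

Local Open Scope classical_set_scope.
Local Open Scope ring_scope.

(** * Absolutely continuous functions *)

Section absolute_continuity.
Context {R : realType}.
Implicit Types (a b e : R) (f g h : R -> R) (l : seq (R * R)) (u v : R * R).

(** Dom [Lmin] has no evident nonzero element: for a smooth compactly supported y, p y' - Q y need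
    not even have an absolutely continuous representative. Density therefore cannot come from test
    functions and is obtained backwards: h orthogonal to the domain means that (0, h) lies in the
    adjoint, hence in [Lmax], which is single-valued, so h = 0. The inclusion of the adjoint in
    [Lmax] has to precede density and is shown without closedness of the range: explicit solutions
    that correct the data at b replace the projection. Values of an L_2 class at a and b exist only
    through its absolutely continuous representative; the passage to integral equations eliminates
    the chosen representatives once and for all. Since p and Q are real, the complex equation splits
    into two real systems with the same coefficients, so the analysis concerns real functions. The
    extension theory is abstract: of [Lmax] it uses linearity, single-valuedness, Green's identity
    and solvability of the initial value problem at a. *)

Definition nonoverlap u v := (u.2 <= v.1) || (v.2 <= u.1).

Definition subitvs a b l :=
  all (fun u => [&& a <= u.1, u.1 <= u.2 & u.2 <= b]) l && pairwise nonoverlap l.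

Definition total_length l := \sum_(u <- l) (u.2 - u.1).

Definition total_jump f l := \sum_(u <- l) `|f u.2 - f u.1|.

(** The real counterpart of [abs_cont]. Families of intervals are lists, so that refinements can be
    built by induction and concatenation. *)
Definition abs_continuous a b f := forall e, 0 < e -> exists2 d : R, 0 < d &
  forall l, subitvs a b l -> total_length l < d -> total_jump f l < e.

Lemma subitvs_cons a b u l : subitvs a b (u :: l) =
  [&& a <= u.1, u.1 <= u.2, u.2 <= b, all (nonoverlap u) l & subitvs a b l].
Proof.
rewrite /subitvs /=; do 3 case: (_ <= _) => //=.
by case: (all (nonoverlap u) l) => //=; rewrite andbF.
Qed.

Lemma total_length_cat l1 l2 :
  total_length (l1 ++ l2) = total_length l1 + total_length l2.
Proof. by rewrite /total_length big_cat. Qed.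

Lemma total_jump_cat f l1 l2 :
  total_jump f (l1 ++ l2) = total_jump f l1 + total_jump f l2.
Proof. by rewrite /total_jump big_cat. Qed.

Lemma abs_continuous_abs_cont a b (F : R -> R[i]) f :
  (forall s t, `|f t - f s| <= Normc.normc (F t - F s)) ->
  abs_cont a b F -> abs_continuous a b f.
Proof.
move=> fF acF e e0; have [d d0 dF] := acF _ e0; exists d => // l.
move=> /andP[/allP lab lno] ld.
pose n := size l; pose ith (i : 'I_n) := nth (a, a) l i.
have lith (i : 'I_n) : ith i \in l by rewrite mem_nth.
apply: le_lt_trans (dF n (fun i => (ith i).1) (fun i => (ith i).2) _ _ _).
- by rewrite /total_jump (big_nth (a, a)) big_mkord ler_sum.
- by move=> i; have /and3P[] := lab _ (lith i).
- move=> i j; rewrite neq_lt => /orP[ij|ij].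
    by have /orP[] := pairwiseP (a, a) lno i j (ltn_ord i) (ltn_ord j) ij; tauto.
  by have /orP[] := pairwiseP (a, a) lno j i (ltn_ord j) (ltn_ord i) ij; tauto.
- by move: ld; rewrite /total_length (big_nth (a, a)) big_mkord.
Qed.

(** A common criterion for differences, with [C] = 1, and for products, where [C] is the sum of
    bounds of the two factors. *)
Lemma abs_continuous_dom a b f g h (C : R) :
  (forall s t, a <= s -> s <= t -> t <= b ->
    `|h t - h s| <= C * (`|f t - f s| + `|g t - g s|)) ->
  abs_continuous a b f -> abs_continuous a b g -> abs_continuous a b h.
Proof.
move=> hC acf acg e e0.
pose D := 1 + `|C|; have D0 : 0 < D by rewrite /D ltr_pwDl.
have e2 : 0 < e / (2 * D) by rewrite divr_gt0// mulr_gt0.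
have [d1 d10 df] := acf _ e2; have [d2 d20 dg] := acg _ e2.
exists (Num.min d1 d2); first by rewrite lt_min d10.
move=> l lab; rewrite lt_min => /andP[/(df _ lab) ef /(dg _ lab) eg].
apply: (@le_lt_trans _ _ (D * (total_jump f l + total_jump g l))); last first.
  have -> : e = D * (e / (2 * D) + e / (2 * D)).
    by field; rewrite gt_eqF.
  by rewrite ltr_pM2l// ltrD.
rewrite /total_jump -big_split /= mulr_sumr big_seq [leRHS]big_seq ler_sum// => u.
move: lab => /andP[/allP lab _] /lab /and3P[u1 u12 u2].
apply: (le_trans (hC _ _ u1 u12 u2)); rewrite ler_wpM2r ?addr_ge0//.
by rewrite /D (le_trans (ler_norm C))// lerDr.
Qed.

Lemma abs_continuousB a b f g :
  abs_continuous a b f -> abs_continuous a b g ->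
  abs_continuous a b (fun x => f x - g x).
Proof.
apply: (@abs_continuous_dom _ _ _ _ _ 1) => s t _ _ _; rewrite mul1r.
have -> : f t - g t - (f s - g s) = (f t - f s) - (g t - g s) by ring.
exact: ler_normB.
Qed.

Lemma itv_partition_subitvs s t (p : seq R) : s <= t -> itv_partition s t p ->
  let m := [seq (u.2, u.1) | u <- zip p (s :: p)] in
  subitvs s t m /\ total_length m = t - s.
Proof.
move=> st lp m.
suff [] : [/\ subitvs s t m, total_length m = t - s & all (fun u => s <= u.1) m].
  by [].
case: lp => lp /eqP lt; rewrite {}/m.
elim: p s lp lt {st} => [s _ /= ->|x l ih s /= /andP[sx xl] lt].
  by split; rewrite ?/total_length ?big_nil ?subrr.
have [h1 h2 h3] := ih x xl lt.
have xt : x <= t by apply: (@itv_partition_le _ _ _ _ l); split => //; apply/eqP.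
split.
- rewrite subitvs_cons /= lexx (ltW sx) xt /=; apply/andP; split.
    by apply: sub_all h3 => u xu; rewrite /nonoverlap /= xu.
  move: h1 => /andP[h1 h1']; rewrite /subitvs h1' andbT.
  apply: sub_all h1 => u /and3P[ux -> ->]; rewrite !andbT.
  exact: le_trans (ltW sx) ux.
- rewrite /total_length big_cons; move: h2; rewrite /total_length => -> /=.
  by ring.
- rewrite /= lexx /=; apply: sub_all h3 => u; apply: le_trans; exact: ltW.
Qed.

Lemma total_variation_abs_continuous_le a b f e d :
  (forall l, subitvs a b l -> total_length l < d -> total_jump f l < e) ->
  forall s t, a <= s -> s <= t -> t <= b -> t - s < d ->
  (total_variation s t f <= e%:E)%E.
Proof.
move=> fd s t as_ st tb std.
rewrite /total_variation; apply: ge_ereal_sup => _ [_ [l lp <-]] <-.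
rewrite lee_fin variation_zip//.
pose m := [seq (u.2, u.1) | u <- zip l (s :: l)].
have -> : \sum_(x <- zip l (s :: l)) `|f x.1 - f x.2| = total_jump f m.
  by rewrite /total_jump big_map.
have [ml mt] := itv_partition_subitvs st lp; rewrite -/m in ml mt.
rewrite ltW// fd// ?mt//.
move: ml => /andP[m1 m2]; rewrite /subitvs m2 andbT.
apply: sub_all m1 => u /and3P[su -> ut]; rewrite (le_trans as_ su).
by rewrite (le_trans ut tb).
Qed.

(** With d answering the tolerance 1, each grid step of length at most d / 2 contributes variation
    at most 1, and finitely many steps, capped at b, exhaust [a, b]. *)
Lemma abs_continuous_bounded_variation a b f : a <= b -> abs_continuous a b f ->
  bounded_variation a b f.
Proof.
move=> ab /(_ _ ltr01)[d d0 dP].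
pose c n := Num.min b (a + n%:R * (d / 2)).
have ac n : a <= c n.
  by rewrite /c le_min ab lerDl mulr_ge0// divr_ge0// ltW.
have cb n : c n <= b by rewrite /c ge_min lexx.
have cS n : c n <= c n.+1.
  rewrite /c le_min ge_min lexx /= ge_min; apply/orP; right.
  by rewrite lerD2l ler_wpM2r ?ler_nat// divr_ge0// ltW.
have TVn n : (total_variation a (c n) f < +oo)%E.
  elim: n => [|n ih].
    by rewrite /c mul0r addr0 (min_idPr ab) total_variationxx ltry.
  rewrite (total_variationD f (ac n) (cS n)) lte_add_pinfty//.
  apply: le_lt_trans (ltry 1).
  apply: (total_variation_abs_continuous_le dP) => //.
  apply: (@le_lt_trans _ _ (d / 2)); last by lra.
  rewrite /c mulrSr mulrDl mul1r.
  set w := n%:R * (d / 2); rewrite lerBlDr.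
  case: (leP b (a + w)) => h1; case: (leP b (a + (w + d / 2))) => h2; lra.
have [n /ltW nb] : exists n, (b - a) / (d / 2) < n%:R.
  by exists (Num.bound ((b - a) / (d / 2))); rewrite archi_boundP//
    divr_ge0 ?subr_ge0// divr_ge0// ltW.
have cnb : c n = b.
  apply/min_idPl; rewrite -lerBlDl -ler_pdivrMr//; lra.
have := TVn n; rewrite cnb => TVb.
by apply/bounded_variationP => //; rewrite ge0_fin_numE// total_variation_ge0.
Qed.

Lemma total_variation_approx a b f s t e : bounded_variation a b f -> a <= s -> s <= t -> t <= b ->
  0 < e -> exists l, [/\ subitvs s t l, total_length l = t - s &
    fine (total_variation s t f) <= total_jump f l + e].
Proof.
move=> bv as_ st tb e0.
have tvfin : total_variation s t f \is a fin_num.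
  apply/bounded_variationP => //.
  by apply: (bounded_variationr as_ st);
    apply: (bounded_variationl (le_trans as_ st) tb).
move: st; rewrite le_eqVlt => /predU1P[->|st].
  exists [::]; split => //; first by rewrite /total_length big_nil subrr.
  by rewrite total_variationxx /total_jump big_nil /= add0r ltW.
have [_ [_ [l lp <-] <-] lt] := @ub_ereal_sup_adherent _ _ _ e0 tvfin.
exists [seq (u.2, u.1) | u <- zip l (s :: l)].
have [h1 h2] := itv_partition_subitvs (ltW st) lp.
split=> //; rewrite -lee_fin EFinD fineK// -leeBlDr// ltW//.
apply: lt_le_trans lt _; rewrite lee_fin variation_zip//.
by rewrite /total_jump big_map.
Qed.

Lemma subitvs_widen a b s t l :
  a <= s -> t <= b -> subitvs s t l -> subitvs a b l.
Proof.
move=> as_ tb /andP[m1 m2]; rewrite /subitvs m2 andbT.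
apply: sub_all m1 => u /and3P[su -> ut]; rewrite (le_trans as_ su).
by rewrite (le_trans ut tb).
Qed.

(** Each interval of l may lose e against its total variation, hence the factor [size l]. The last
    clause carries the induction: pieces of nonoverlapping intervals do not overlap. *)
Lemma subitvs_refine a b f l e : bounded_variation a b f -> 0 < e -> subitvs a b l ->
  exists l', [/\ subitvs a b l', total_length l' = total_length l,
    \sum_(u <- l) fine (total_variation u.1 u.2 f) <= total_jump f l' + e *+ size l &
    forall v, v \in l' -> exists2 u, u \in l & u.1 <= v.1 /\ v.2 <= u.2].
Proof.
move=> bv e0; elim: l => [_|u l ih].
  by exists [::]; split => //; rewrite /total_jump !big_nil addr0.
rewrite subitvs_cons => /and5P[au u12 ub uno /ih[l' [l'ab l'l jl l'sub]]].
have [m [muv mlen mj]] := total_variation_approx bv au u12 ub e0.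
have mu12 v : v \in m -> u.1 <= v.1 /\ v.2 <= u.2.
  by move: muv => /andP[/allP h _] /h /and3P[].
exists (m ++ l'); split.
- have /andP[m1 m2] := subitvs_widen au ub muv.
  have /andP[l1 l2] := l'ab.
  rewrite /subitvs all_cat m1 l1 pairwise_cat m2 l2 !andbT /=.
  apply/allrelP => x y /mu12[ux xu] /l'sub[w /(allP uno) + [wy yw]].
  rewrite /nonoverlap => /orP[h|h]; apply/orP; [left|right].
    by rewrite (le_trans xu)// (le_trans h).
  by rewrite (le_trans yw)// (le_trans h).
- by rewrite total_length_cat mlen l'l /total_length big_cons.
- rewrite big_cons total_jump_cat /= mulrS addrACA lerD//.
- move=> v; rewrite mem_cat => /orP[/mu12 h|/l'sub[w wl h]].
    by exists u; rewrite ?mem_head.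
  by exists w; rewrite // inE wl orbT.
Qed.

(** The increments of the variation over l are, up to any r > 0, jumps of f over a refinement of l
    of the same total length, so the d found for f serves. Letting r tend to 0 loses strictness,
    which is why f is used with e / 2. *)
Lemma abs_continuous_total_variation a b f : a <= b -> abs_continuous a b f ->
  abs_continuous a b (fun x => fine (total_variation a x f)).
Proof.
move=> ab acf e e0; have bv := abs_continuous_bounded_variation ab acf.
have [d d0 df] := acf _ (divr_gt0 e0 (ltr0n _ 2)); exists d => // l lab ld.
apply: (@le_lt_trans _ _ (e / 2)); last by lra.
have -> : total_jump (fun x => fine (total_variation a x f)) l =
    \sum_(u <- l) fine (total_variation u.1 u.2 f).
  rewrite /total_jump big_seq [RHS]big_seq; apply: eq_bigr => u.
  move: lab => /andP[/allP lab _] /lab /and3P[u1 u12 u2].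
  have fina x : a <= x -> x <= b -> total_variation a x f \is a fin_num.
    by move=> ax xb; apply/bounded_variationP => //; exact: (bounded_variationl ax xb).
  have finu : total_variation u.1 u.2 f \is a fin_num.
    apply/bounded_variationP => //.
    by apply: (bounded_variationr u1 u12);
      apply: (bounded_variationl (le_trans u1 u12) u2).
  rewrite (total_variationD f u1 u12) fineD// ?fina// ?(le_trans u12)//.
  by rewrite addrC addKr ger0_norm// fine_ge0// total_variation_ge0.
apply/ler_addgt0Pr => r r0.
(* The successor keeps the divisor nonzero when l is empty. *)
have r'0 : 0 < r / (size l).+1%:R by rewrite divr_gt0.
have [l' [l'ab l'l jl _]] := subitvs_refine bv r'0 lab.
apply: (le_trans jl); rewrite lerD//; first by rewrite ltW// df// l'l.
rewrite -[X in X <= _]mulrnAl ler_pdivrMr// -mulr_natr ler_pM2l// ler_nat.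
exact: leqnSn.
Qed.

(* The Jordan decomposition f = V - (V - f). *)
Lemma abs_continuous_nondecreasing_sub a b f : a <= b -> abs_continuous a b f ->
  exists g h, [/\ abs_continuous a b g, abs_continuous a b h,
    {in `[a, b] &, nondecreasing_fun g}, {in `[a, b] &, nondecreasing_fun h} &
    forall x, f x = g x - h x].
Proof.
move=> ab acf; have bv := abs_continuous_bounded_variation ab acf.
have acV := abs_continuous_total_variation ab acf.
pose V x := fine (total_variation a x f).
have fina x y : a <= x -> x <= y -> y <= b -> total_variation x y f \is a fin_num.
  move=> ax xy yb; apply/bounded_variationP => //.
  by apply: (bounded_variationr ax xy);
    apply: (bounded_variationl (le_trans ax xy) yb).
have VB x y : a <= x -> x <= y -> y <= b ->
    V y = V x + fine (total_variation x y f).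
  move=> ax xy yb; rewrite /V (total_variationD f ax xy) fineD// ?fina//.
  exact: le_trans yb.
exists V, (fun x => V x - f x); split=> //.
- exact: abs_continuousB.
- move=> x y; rewrite !in_itv /= => /andP[ax xb] /andP[ay yb] xy.
  by rewrite (VB x y)// lerDl fine_ge0// total_variation_ge0.
- move=> x y; rewrite !in_itv /= => /andP[ax xb] /andP[ay yb] xy.
  rewrite (VB x y)// -addrA lerD2l -lerBlDr.
  have := total_variation_ge f xy.
  rewrite -(fineK (fina _ _ ax xy yb)) lee_fin; apply: le_trans.
  by rewrite opprK addrC ler_norm.
- by move=> x; rewrite opprB addrC subrK.
Qed.

End absolute_continuity.

(** * Stieltjes measures dominated by Lebesgue measure *)

Section stieltjes_domination.
Context {R : realType}.
Local Notation mu := (@lebesgue_measure R).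
Implicit Types (F : cumulative R R) (l : seq (R * R)).

(** Half-open on the left, as in the semiring on which Stieltjes measures are built; intervals
    sharing an endpoint become disjoint sets. *)
Definition oc (u : R * R) : set R := `]u.1, u.2]%classic.

Lemma wlength_oc F u : u.1 <= u.2 -> wlength F (oc u) = (F u.2 - F u.1)%:E.
Proof. by move=> u12; rewrite wlength_itv_bnd. Qed.

Lemma stieltjes_oc F u : u.1 <= u.2 ->
  lebesgue_stieltjes_measure F (oc u) = (F u.2 - F u.1)%:E.
Proof.
move=> u12; rewrite /lebesgue_stieltjes_measure /measure_extension.
rewrite measurable_mu_extE; first exact: wlength_oc.
by case: u u12 => s t _; exact: (@is_ocitv R s t).
Qed.

Lemma measurable_oc u : measurable (oc u : set (measurableTypeR R)).
Proof. exact: measurable_itv. Qed.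

Lemma nonoverlap_disjoint u v : nonoverlap u v -> oc u `&` oc v = set0.
Proof.
move=> uv; rewrite -subset0 => x; rewrite /oc /= !in_itv /=.
move=> [/andP[ux xu] /andP[vx xv]]; move: uv => /orP[h|h].
  by move: (le_lt_trans (le_trans xu h) vx); rewrite ltxx.
by move: (le_lt_trans (le_trans xv h) ux); rewrite ltxx.
Qed.

(** Strict inequalities matter: a degenerate half-open interval is empty, hence disjoint even from
    an interval having its endpoint in the interior. *)
Lemma disjoint_nonoverlap u v : u.1 < u.2 -> v.1 < v.2 ->
  oc u `&` oc v = set0 -> nonoverlap u v.
Proof.
move=> u12 v12 uv; rewrite /nonoverlap; apply: contrapT => /negP.
rewrite negb_or -!ltNge => /andP[h1 h2].
have : (oc u `&` oc v) (Num.min u.2 v.2).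
  by split; rewrite /oc /= in_itv /= !lt_min !ge_min !lexx ?u12 ?v12 ?h1 ?h2 ?orbT.
by rewrite uv.
Qed.

Lemma stieltjes_nonoverlap F l : (forall u, u \in l -> u.1 <= u.2) ->
  pairwise nonoverlap l ->
  lebesgue_stieltjes_measure F (\big[setU/set0]_(u <- l) oc u) =
  (\sum_(u <- l) (F u.2 - F u.1))%:E.
Proof.
elim: l => [_ _|u l ih lu /= /andP[/allP ul pl]]; first by rewrite !big_nil measure0.
rewrite !big_cons EFinD -ih//; last by move=> v vl; apply: lu; rewrite inE vl orbT.
rewrite measureU//; first by congr (_ + _)%E; apply: stieltjes_oc; rewrite lu// mem_head.
- exact: measurable_oc.
- by apply: bigsetU_measurable => v _; exact: measurable_oc.
- rewrite big_seq; elim/big_ind : _ => [|A B uA uB|v vl]; rewrite ?setI0//.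
    by rewrite setIUr uA uB setU0.
  exact/nonoverlap_disjoint/ul.
Qed.

(** A finite union of half-open intervals belongs to the ring they generate, and elements of that
    ring are finite disjoint unions of nonempty half-open intervals. *)
Lemma ocitv_nonoverlap (s : seq (set R)) : (forall A, A \in s -> ocitv A) ->
  exists l, [/\ forall u, u \in l -> u.1 <= u.2, pairwise nonoverlap l &
    \big[setU/set0]_(A <- s) A = \big[setU/set0]_(u <- l) oc u].
Proof.
move=> so.
pose U : set (SetRing.type (ocitv_type R)) := \big[setU/set0]_(A <- s) A.
have mU : measurable U.
  rewrite /U big_seq; apply: bigsetU_measurable => A /so oA.
  exact: SetRing.measurable_subring.
have [B [/finite_seqP[t BE] B0 tB mB UB]] := SetRing.ring_finite_set mU.
have Bt A : A \in undup t -> B A by rewrite mem_undup BE.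
have ocB (A : set R) : {u : R * R | B A -> u.1 < u.2 /\ A = oc u}.
  apply: cid; case: (pselect (B A)) => [BA|]; last by exists (0, 0).
  have /mB/ocitvP[A0|[u u12 Au]] : A \in B by rewrite inE.
    by have := B0 _ BA; rewrite A0 => -[].
  by exists u.
pose r (A : set R) := sval (ocB A).
have rP A : B A -> (r A).1 < (r A).2 /\ A = oc (r A) by exact: (svalP (ocB A)).
(* The enumeration t of the pieces may have repetitions, and a repeated interval would overlap
   itself. *)
exists [seq r A | A <- undup t]; split.
- by move=> _ /mapP[A /Bt/rP[+ _] ->]; exact: ltW.
- have := undup_uniq t; move: (undup t) Bt => {BE}; elim=> //= A q ih Bq /andP[Aq uq].
  rewrite ih ?andbT//; last by move=> C Cq; apply: Bq; rewrite inE Cq orbT.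
  apply/allP => _ /mapP[C Cq ->].
  have /rP[rA AE] := Bq A (mem_head _ _).
  have BC : B C by apply: Bq; rewrite inE Cq orbT.
  have /rP[rC CE] := BC.
  apply: disjoint_nonoverlap => //; rewrite -AE -CE.
  have [//|/set0P AC] := eqVneq (A `&` C) set0.
  by move: Cq; rewrite -(tB _ _ (Bq A (mem_head _ _)) BC AC) (negbTE Aq).
- rewrite big_map -/U [LHS]UB BE; apply/seteqP; split.
    move=> x [A /= At Ax]; rewrite -bigcup_seq.
    exists A; first by rewrite /= mem_undup.
    by have /rP[_ <-] : B A by rewrite BE.
  move=> x; rewrite -bigcup_seq => -[A /= At xA].
  exists A; first by rewrite /= -mem_undup.
  by have /rP[_ ->] : B A by rewrite BE /= -mem_undup.
Qed.

(** Continuity from below reduces the countable cover to its finite subunions. Rewritten without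
    overlaps, such a union has its jump sum as Stieltjes measure, while its length is at most that
    of the cover by subadditivity. *)
Lemma stieltjes_cover_le F (d e : R) (A : nat -> set R) :
  (forall l, (forall u, u \in l -> u.1 <= u.2) -> pairwise nonoverlap l ->
    total_length l < d -> total_jump F l <= e) ->
  (forall k, ocitv (A k)) ->
  (\sum_(k <oo) wlength (@idfun R) (A k) < d%:E)%E ->
  (lebesgue_stieltjes_measure F (\bigcup_k A k) <= e%:E)%E.
Proof.
move=> Fd oA Ad.
have mA k : measurable (A k : set (measurableTypeR R)).
  by apply: sub_sigma_algebra; exact: oA.
pose B n : set (measurableTypeR R) := \big[setU/set0]_(k < n) A k.
have mB n : measurable (B n) by apply: bigsetU_measurable => k _; exact: mA.
have UB : \bigcup_n B n = \bigcup_k A k.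
  apply/seteqP; split=> [x [n _]|x [k _ Ak]].
    by rewrite /B -bigcup_mkord => -[k _ Ak]; exists k.
  by exists k.+1 => //; rewrite /B -bigcup_mkord; exists k => /=.
have cvB : lebesgue_stieltjes_measure F \o B @ \oo -->
    lebesgue_stieltjes_measure F (\bigcup_n B n).
  apply: nondecreasing_cvg_mu => //; first exact: bigcup_measurable.
  by move=> m n mn; apply/subsetPset; exact: subset_bigsetU.
rewrite -UB -(cvg_lim _ cvB)//; apply: lime_le; first by apply/cvg_ex; eexists; exact: cvB.
apply: nearW => n /=.
have [A' A's] : exists s : seq (set R), s = [seq A k | k <- iota 0 n] by eexists.
have BE : B n = \big[setU/set0]_(C <- A') C.
  by rewrite A's big_map /B -(big_mkord xpredT A) /index_iota subn0.
have oA' C : C \in A' -> ocitv C by rewrite A's => /mapP[k _ ->].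
have [l [l12 lno lE]] := ocitv_nonoverlap oA'.
rewrite BE lE stieltjes_nonoverlap// lee_fin.
suff : total_length l < d.
  move=> /(Fd _ l12 lno); apply: le_trans; rewrite /total_jump ler_sum// => u _.
  exact: ler_norm.
rewrite -lte_fin.
have -> : (total_length l)%:E = mu (\big[setU/set0]_(u <- l) oc u).
  exact: esym (stieltjes_nonoverlap (@idfun R) l12 lno).
rewrite -lE -BE.
apply: le_lt_trans Ad.
apply: (@le_trans _ _ (\sum_(0 <= k < n) wlength (@idfun R) (A k))%E); last first.
  by apply: nneseries_lim_ge => k _ _; exact: wlength_ge0.
rewrite big_mkord; apply: (@le_trans _ _ (\sum_(k < n) mu (A k))%E).
  exact: (@Boole_inequality _ _ _ mu A n (fun k _ => mA k)).
apply: lee_sum => k _; rewrite /lebesgue_measure /lebesgue_stieltjes_measure.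
by rewrite /measure_extension measurable_mu_extE//; exact: oA.
Qed.

(** Lebesgue measure is an infimum over covers by half-open intervals, so a null set has a cover of
    total length below any d. *)
Lemma stieltjes_dominates F :
  (forall e, 0 < e -> exists2 d : R, 0 < d & forall l,
    (forall u, u \in l -> u.1 <= u.2) -> pairwise nonoverlap l ->
    total_length l < d -> total_jump F l <= e) ->
  lebesgue_stieltjes_measure F `<< mu.
Proof.
move=> Fac; apply/null_content_dominatesP => A mA A0.
apply/eqP; rewrite eq_le measure_ge0 andbT; apply/lee_addgt0Pr => e e0.
rewrite add0e; have [d d0 dF] := Fac _ e0.
have : (mu A < d%:E)%E by rewrite A0 lte_fin.
rewrite /lebesgue_measure /lebesgue_stieltjes_measure {1}/measure_extension /mu_ext.
move=> /ereal_inf_lt[_ [C [mC AC] <-] Cd].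
apply: le_trans (stieltjes_cover_le dF mC Cd).
rewrite le_measure ?inE//; apply: bigcup_measurable => k _.
by apply: sub_sigma_algebra; exact: mC.
Qed.

End stieltjes_domination.

(** * Radon-Nikodym densities of monotone absolutely continuous functions *)

Section primitives.
Context {R : realType}.
Local Notation mu := (@lebesgue_measure R).
Variables (a b : R).
Hypothesis ab : a < b.
Implicit Types (f g h k : R -> R) (l : seq (R * R)).
Local Notation J := (`]a, b[%classic : set R).

(** The integral form of absolute continuity with the derivative h as explicit data; f is
    unconstrained outside [a, b]. *)
Definition primitive h f := mu.-integrable J (EFin \o h) /\
  forall x, x \in `[a, b] -> f x = f a + \int[mu]_(t in `]a, x[) h t.

(** Composition with [clamp] extends f by constants beyond [a, b], since a cumulative function lives
    on the whole line. As [clamp] is monotone and shrinks lengths, absolute continuity survives. *)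
Let clamp (x : R) := Num.max a (Num.min b x).

Let clamp_itv x : a <= clamp x <= b.
Proof. by rewrite /clamp le_max lexx /= ge_max ge_min lexx /= (ltW ab). Qed.

Let clamp_id x : a <= x -> x <= b -> clamp x = x.
Proof. by move=> ax xb; rewrite /clamp (min_idPr xb) (max_idPr ax). Qed.

Let clamp_nd x y : x <= y -> clamp x <= clamp y /\ clamp y - clamp x <= y - x.
Proof.
rewrite /clamp => xy.
by case: (leP b x) => bx; case: (leP b y) => yb;
  case: (leP a b) => ?; case: (leP a x) => ?; case: (leP a y) => ?;
  rewrite ?subrr ?lexx ?subr_ge0 //; split; lra.
Qed.

Lemma abs_continuous_nondecreasing_primitive f :
  {in `[a, b] &, nondecreasing_fun f} -> abs_continuous a b f ->
  exists h, primitive h f.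
Proof.
move=> ndf acf; pose F x := f (clamp x).
have ndF : nondecreasing F.
  move=> x y xy; apply: ndf; rewrite ?in_itv /= ?clamp_itv//.
  by have [] := clamp_nd xy.
have acF e : 0 < e -> exists2 d : R, 0 < d & forall l,
    (forall u, u \in l -> u.1 <= u.2) -> pairwise nonoverlap l ->
    total_length l < d -> total_jump F l <= e.
  move=> /acf[d d0 dP]; exists d => // l l12 lno ld.
  pose m := [seq (clamp u.1, clamp u.2) | u <- l].
  have -> : total_jump F l = total_jump f m by rewrite /total_jump /m big_map.
  apply/ltW/dP.
    apply/andP; split.
      apply/allP => _ /mapP[u ul ->] /=.
      have /andP[-> _] := clamp_itv u.1; have /andP[_ ->] := clamp_itv u.2.
      by have [-> _] := clamp_nd (l12 _ ul).
    rewrite pairwise_map; apply: sub_pairwise lno => u v; rewrite /nonoverlap /=.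
    by move=> /orP[] /clamp_nd[-> _]; rewrite ?orbT.
  apply: le_lt_trans ld; rewrite /total_length /m big_map /= big_seq [leRHS]big_seq.
  by apply: ler_sum => u /l12 /clamp_nd[].
have rcF : right_continuous F.
  move=> x; apply/cvgrPdist_le => e e0; have [d d0 dP] := acF _ e0.
  near=> y.
  have xy : x <= y by near: y; exact: nbhs_right_ge.
  have := dP [:: (x, y)]; rewrite /total_jump /total_length !big_seq1 /= distrC.
  apply => //; first by move=> u; rewrite inE => /eqP ->.
  by rewrite ltrBlDl; near: y; apply: nbhs_right_lt; rewrite ltrDl.
pose Fm := isCumulative.Build R _ R F ndF rcF.
pose Fc : cumulative R R := HB.pack F Fm.
pose nu := lebesgue_stieltjes_measure Fc.
have mab : measurable (oc (a, b) : set (measurableTypeR R)) by exact: measurable_itv.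
have nuab : (nu (oc (a, b)) < +oo)%E by rewrite /nu stieltjes_oc ?ltW//= ltry.
(* Restriction to ]a, b] supplies the finite measure required by Radon-Nikodym; it loses nothing,
   since every ]a, x] in question lies inside. *)
pose nur := mfrestr mab nuab.
have dom : nur `<< mu.
  have /null_content_dominatesP numu := @stieltjes_dominates R Fc acF.
  apply/null_content_dominatesP => A mA A0; rewrite /nur /mfrestr /mrestr.
  apply: (@subset_measure0 _ _ _ nu _ A) => //; first exact: measurableI.
  exact: numu.
have [h [h0 hfin hint hE]] := @radon_nikodym_sigma_finite _ _ _ mu nur dom.
have hfine : EFin \o (fine \o h) = h by apply/funext => x /=; rewrite fineK.
exists (fine \o h); split; rewrite ?hfine.
  by apply: integrableS hint.
move=> x; rewrite in_itv /= => /andP[ax xb].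
rewrite Rintegral_itv_bndo_bndc ?hfine; last exact: integrableS hint.
have := hE `]a, x]%classic (measurable_itv _).
have nurE : nur `]a, x]%classic = (f x - f a)%:E.
  rewrite -[LHS]/(nu (oc (a, x) `&` oc (a, b))) setIidl; last first.
    by move=> y /=; rewrite /oc /= !in_itv /= => /andP[-> /le_trans]; exact.
  by rewrite /nu stieltjes_oc//= /F !clamp_id ?(ltW ab).
move=> /(etrans (esym nurE)) /(congr1 (@fine R)) /= E; rewrite /Rintegral.
by under eq_integral do rewrite fineK//; rewrite -E addrC subrK.
Unshelve. all: by end_near. Qed.

End primitives.

(** * Primitives of integrable functions *)

Section abs_cont_of_lists.
Context {R : realType} (a b : R).

Lemma abs_continuous_complex (F : R -> R[i]) :
  abs_continuous a b (@complex.Re R \o F) ->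
  abs_continuous a b (@complex.Im R \o F) -> abs_cont a b F.
Proof.
move=> acr aci e e0; have e2 : 0 < e / 2 by rewrite divr_gt0.
have [d1 d10 d1P] := acr _ e2; have [d2 d20 d2P] := aci _ e2.
exists (Num.min d1 d2); first by rewrite lt_min d10.
move=> n s t st no; rewrite lt_min => /andP[s1 s2].
pose l := [seq (s i, t i) | i <- enum 'I_n].
have ll : total_length l = \sum_(i < n) (t i - s i).
  by rewrite /total_length /l big_map big_enum.
have lab : subitvs a b l.
  apply/andP; split.
    by apply/allP => _ /mapP[i _ ->] /=; apply/and3P; exact: st.
  rewrite pairwise_map; have := enum_uniq 'I_n; rewrite uniq_pairwise.
  by apply: sub_pairwise => i j ij; apply/orP; have [] := no _ _ ij; tauto.
have jl f : total_jump f l = \sum_(i < n) `|f (t i) - f (s i)|.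
  by rewrite /total_jump /l big_map big_enum.
have := ltrD (d1P l lab _) (d2P l lab _); rewrite ll -splitr => /(_ s1 s2).
apply: le_lt_trans; rewrite !jl -big_split /=.
apply: ler_sum => i _ /=; case: (F (t i)) (F (s i)) => [x1 y1] [x2 y2] /=.
set x := x1 - x2; set y := y1 - y2.
rewrite -[leRHS]ger0_norm ?addr_ge0// -sqrtr_sqr ler_wsqrtr//.
have hx : `|x| ^+ 2 = x ^+ 2 by exact: real_normK (num_real x).
have hy : `|y| ^+ 2 = y ^+ 2 by exact: real_normK (num_real y).
by rewrite -hx -hy sqrrD -addrA lerD2l lerDr mulrn_wge0// mulr_ge0.
Qed.

End abs_cont_of_lists.

Section primitive_theory.
Context {R : realType}.
Local Notation mu := (@lebesgue_measure R).
Variables (a b : R).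
Hypothesis ab : a < b.
Implicit Types (f g h k : R -> R) (l : seq (R * R)).
Local Notation J := (`]a, b[%classic : set R).
Local Notation primitive := (primitive a b).

Lemma subJ x : x <= b -> `]a, x[%classic `<=` J.
Proof. by move=> xb y /=; rewrite !in_itv /= => /andP[-> /lt_le_trans]; exact. Qed.

Lemma integrable_lin c d h k : mu.-integrable J (EFin \o h) ->
  mu.-integrable J (EFin \o k) ->
  mu.-integrable J (EFin \o (fun x => c * h x + d * k x)).
Proof.
move=> ih ik.
have -> : EFin \o (fun x => c * h x + d * k x) =
    (fun x => c%:E * (EFin \o h) x)%E \+ (fun x => d%:E * (EFin \o k) x)%E.
  by apply/funext => x /=; rewrite EFinD !EFinM.
apply: integrableD => //; exact: integrableZl.
Qed.

Lemma primitive_lin c d h f k g : primitive h f -> primitive k g ->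
  primitive (fun x => c * h x + d * k x) (fun x => c * f x + d * g x).
Proof.
move=> [ih Ef] [ik Eg].
split; first exact: integrable_lin.
move=> x xab; rewrite Ef// Eg//.
have xb : x <= b by move: xab; rewrite in_itv => /andP[].
have iS u : mu.-integrable J (EFin \o u) -> mu.-integrable `]a, x[ (EFin \o u).
  by apply: integrableS => //; exact: subJ.
have iZ r u : mu.-integrable J (EFin \o u) ->
    mu.-integrable `]a, x[ (EFin \o (fun t => r * u t)).
  move=> iu; apply: iS; have := integrable_lin r 0 iu iu.
  by congr (_.-integrable _ (_ \o _)); apply/funext => t; rewrite mul0r addr0.
rewrite RintegralD//; [|exact: iZ|exact: iZ].
by rewrite !RintegralZl//; [ring|exact: iS|exact: iS].
Qed.

Lemma abs_continuous_primitive f :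
  abs_continuous a b f -> exists h, primitive h f.
Proof.
move=> /(abs_continuous_nondecreasing_sub (ltW ab))[g [k [acg ack ndg ndk fE]]].
have [h1 p1] := abs_continuous_nondecreasing_primitive ab ndg acg.
have [h2 p2] := abs_continuous_nondecreasing_primitive ab ndk ack.
have := primitive_lin 1 (-1) p1 p2; set h := (fun _ => _) => p.
exists h; suff -> : f = (fun x => 1 * g x + -1 * k x) by [].
by apply/funext => x; rewrite fE mul1r mulN1r.
Qed.

Lemma primitive_integral h c : mu.-integrable J (EFin \o h) ->
  primitive h (fun x => c + \int[mu]_(t in `]a, x[) h t).
Proof.
by move=> ih; split=> // x _; rewrite set_itvoo0 ?lexx// Rintegral_set0 addr0.
Qed.

(** Extension of h by zero gives an integrable function on the line, the setting of the first
    fundamental theorem and of absolute continuity of the integral. *)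
Lemma primitive_restrict h f : primitive h f ->
  mu.-integrable setT (EFin \o (h \_ J)) /\
  forall x, x \in `[a, b] -> f x = f a + \int[mu]_(t in `]a, x]) (h \_ J) t.
Proof.
move=> [ih fE]; have iJ : mu.-integrable setT (EFin \o (h \_ J)).
  by rewrite -restrict_EFin; apply/integrable_restrict => //; rewrite setTI.
split=> // x xab; rewrite fE// -Rintegral_itv_bndo_bndc; last exact: integrableS iJ.
congr (_ + _); apply: eq_Rintegral => y; rewrite inE => yx.
rewrite patchE mem_set//; apply: subJ yx.
by move: xab; rewrite in_itv => /andP[].
Qed.

Lemma primitive_sub h f s t : primitive h f -> a <= s -> s <= t -> t <= b ->
  f t - f s = \int[mu]_(x in `]s, t]) (h \_ J) x.
Proof.
move=> /primitive_restrict[iJ fE] as_ st tb.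
rewrite fE ?in_itv /= ?tb ?(le_trans as_)// [f s]fE ?in_itv /= ?as_ ?(le_trans st)//.
rewrite opprD addrACA subrr add0r.
by rewrite Rintegral_itvB//; exact: integrableS iJ.
Qed.

Lemma primitive_abs_continuous h f : primitive h f -> abs_continuous a b f.
Proof.
move=> p; have [iJ _] := primitive_restrict p => e e0.
have [d [d0 dP]] := integral_normr_continuous iJ e0; exists d => // l lab ld.
have iN : mu.-integrable setT (EFin \o (fun x => `|(h \_ J) x|)).
  exact: integrable_norm.
pose U (l : seq (R * R)) : set (measurableTypeR R) := \big[setU/set0]_(u <- l) oc u.
have mU m : measurable (U m).
  by apply: bigsetU_measurable => v _; exact: measurable_oc.
have muU m : subitvs a b m -> mu (U m) = (total_length m)%:E.
  move=> /andP[/allP m1 m2].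
  apply: (stieltjes_nonoverlap (@idfun R) _ m2) => u /m1 /and3P[//].
have Ul : (mu (U l) < d%:E)%E by rewrite muU.
apply: le_lt_trans (dP (U l) (mU l) Ul).
clear Ul.
clear dP; elim: l lab ld => [_ _|u l ih].
  by rewrite /U /total_jump !big_nil Rintegral_set0.
rewrite subitvs_cons => /and5P[au u12 ub /allP uno lab] ld.
rewrite /U big_cons Rintegral_setU//.
- rewrite /total_jump big_cons; apply: lerD.
    rewrite (primitive_sub p)// le_normr_Rintegral//.
    exact: integrableS iJ.
  apply: ih => //; move: ld; rewrite /total_length big_cons.
  by apply: le_lt_trans; rewrite lerDr subr_ge0.
- exact: measurable_oc.
- exact: mU.
- by apply: integrableS iN => //; apply: measurableU; [exact: measurable_oc|exact: mU].
- apply/disj_setPS; rewrite big_seq; elim/big_ind : _ => [|A B uA uB|v vl].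
  + by rewrite setI0.
  + by rewrite setIUr subUset.
  + by rewrite nonoverlap_disjoint// uno.
Qed.

Lemma abs_continuous_continuous f :
  abs_continuous a b f -> {within `[a, b], continuous f}.
Proof.
move=> acf; apply/subspace_continuousP => x /= xab.
apply/cvgrPdist_lt => e e0; have [d d0 dP] := acf _ e0.
rewrite near_withinE; near=> y => yab.
have [ax xb] : a <= x /\ x <= b by move: xab; rewrite in_itv => /andP[].
have [ay yb] : a <= y /\ y <= b by move: yab; rewrite /= in_itv => /andP[].
have xyd : `|x - y| < d by near: y; exact: cvgr_dist_lt.
case: (leP x y) xyd => [xy|/ltW yx].
  rewrite distrC ger0_norm ?subr_ge0// => yxd.
  have := dP [:: (x, y)]; rewrite /total_length /total_jump !big_seq1 /= distrC.
  by apply => //; rewrite subitvs_cons /= ax xy yb.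
rewrite ger0_norm ?subr_ge0// => yxd.
have := dP [:: (y, x)]; rewrite /total_length /total_jump !big_seq1 /=.
by apply => //; rewrite subitvs_cons /= ay yx xb.
Unshelve. all: by end_near. Qed.

Lemma abs_continuous_measurable f : abs_continuous a b f -> measurable_fun J f.
Proof.
move=> /abs_continuous_continuous cf.
apply: (@measurable_funS _ _ _ _ `[a, b]%classic) => //.
  by move=> x /=; rewrite !in_itv /= => /andP[/ltW -> /ltW ->].
exact: subspace_continuous_measurable_fun.
Qed.

Lemma abs_continuous_bounded f : abs_continuous a b f ->
  exists2 M, 0 <= M & forall x, x \in `[a, b] -> `|f x| <= M.
Proof.
move=> acf; have := abs_continuous_bounded_variation (ltW ab) acf.
move=> /(bounded_variationP _ (ltW ab)) fin.
exists (`|f a| + fine (total_variation a b f)).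
  by rewrite addr_ge0// fine_ge0// total_variation_ge0// ltW.
move=> x; rewrite in_itv /= => /andP[ax xb].
have -> : f x = f a + (f x - f a) by rewrite addrC subrK.
apply: (le_trans (ler_normD _ _)); rewrite lerD2l -lee_fin fineK//.
apply: (le_trans (total_variation_ge f ax)).
by rewrite (total_variationD f ax xb) leeDl// total_variation_ge0.
Qed.

Lemma primitive_is_derive h f : primitive h f ->
  {ae mu, forall x, J x -> is_derive x 1 f (h x)}.
Proof.
move=> /primitive_restrict[iJ fE].
have := @FTC1 R (h \_ J) (BRight a) _ _.
have iJ' y : mu.-integrable [set` Interval (BRight a) (BRight y)] (EFin \o h \_ J).
  exact: integrableS iJ.
have lJ : locally_integrable [set: R] (h \_ J).
  by have := integrable_locally measurableT iJ; rewrite patch_setT.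
move=> /(_ iJ' lJ).
apply: filterS; first exact: (ae_filter_ringOfSetsType mu).
move=> x D Jx; have [ax xb] : a < x /\ x < b by move: Jx; rewrite /= in_itv => /andP[].
have [|dF FE] := D; first exact: ax.
have fE' : \forall y \near x,
    f a + \int[mu]_(t in `]a, y]) (h \_ J) t = f y.
  have : nbhs x J by apply: open_nbhs_nbhs; split => //; exact: itv_open.
  apply: filterS => y; rewrite /= in_itv => /andP[/ltW ay /ltW yb].
  by rewrite -fE// in_itv; apply/andP.
apply: near_eq_is_derive fE' _; rewrite -[h x]add0r.
have -> : h x = (h \_ J) x by rewrite patchE mem_set.
have dF1 : is_derive x 1 (fun y => \int[mu]_(t in `]a, y]) (h \_ J) t) ((h \_ J) x).
  by apply: DeriveDef; [exact: dF|rewrite -derive1E].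
exact: (is_deriveD (is_derive_cst (f a) x 1) dF1).
Qed.

Lemma primitive_congr h k f : primitive h f -> mu.-integrable J (EFin \o k) ->
  {ae mu, forall x, J x -> h x = k x} -> primitive k f.
Proof.
move=> [ih fE] ik hk; split=> // x xab; rewrite fE//; congr (_ + fine _).
have xb : x <= b by move: xab; rewrite in_itv => /andP[].
apply: ae_eq_integral => //.
- by apply: measurable_funS (measurable_int _ ih) => //; exact: subJ.
- by apply: measurable_funS (measurable_int _ ik) => //; exact: subJ.
apply: filterS hk; first exact: (ae_filter_ringOfSetsType mu).
by move=> y hky /(subJ xb) /hky /= ->.
Qed.

Lemma integrable_mul_bounded h f : mu.-integrable J (EFin \o h) ->
  abs_continuous a b f -> mu.-integrable J (EFin \o (fun x => h x * f x)).
Proof.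
move=> ih acf; have [M M0 fM] := abs_continuous_bounded acf.
apply: (@le_integrable _ _ _ mu J _ _ (EFin \o (fun x => M * h x))) => //.
- apply/measurable_EFinP; apply: measurable_funM.
    by apply/measurable_EFinP; exact: measurable_int ih.
  exact: abs_continuous_measurable.
- move=> x Jx /=; rewrite lee_fin !normrM mulrC ler_wpM2r// (ger0_norm M0) fM//.
  by move: Jx; rewrite /= !in_itv /= => /andP[/ltW -> /ltW ->].
- have := integrable_lin M 0 ih ih.
  by congr (_.-integrable _ (_ \o _)); apply/funext => t; rewrite mul0r addr0.
Qed.

(** No Fubini argument is needed: the product is absolutely continuous, hence a primitive of some m,
    and the pointwise product rule identifies m almost everywhere. *)
Lemma primitive_mul h f k g : primitive h f -> primitive k g ->
  primitive (fun x => h x * g x + k x * f x) (fun x => f x * g x).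
Proof.
move=> pf pg; have acf := primitive_abs_continuous pf.
have acg := primitive_abs_continuous pg.
have [M M0 fM] := abs_continuous_bounded acf.
have [N N0 gN] := abs_continuous_bounded acg.
have [m pfg] : exists m, primitive m (fun x => f x * g x).
  apply: abs_continuous_primitive.
  apply: (@abs_continuous_dom _ _ _ f g _ (M + N)) => // s t as_ st tb.
  have -> : f t * g t - f s * g s = f t * (g t - g s) + g s * (f t - f s) by ring.
  apply: (le_trans (ler_normD _ _)); rewrite !normrM.
  have := fM t; rewrite in_itv /= tb (le_trans as_ st) => /(_ isT) ft.
  have := gN s; rewrite in_itv /= as_ (le_trans st tb) => /(_ isT) gs.
  have := ler_wpM2r (normr_ge0 (g t - g s)) ft.
  have := ler_wpM2r (normr_ge0 (f t - f s)) gs.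
  have := mulr_ge0 M0 (normr_ge0 (f t - f s)).
  have := mulr_ge0 N0 (normr_ge0 (g t - g s)).
  lra.
apply: (primitive_congr pfg).
  have := integrable_lin 1 1 (integrable_mul_bounded pf.1 acg)
    (integrable_mul_bounded pg.1 acf).
  by congr (_.-integrable _ (_ \o _)); apply/funext => t; rewrite !mul1r.
have := primitive_is_derive pf; have := primitive_is_derive pg.
have := primitive_is_derive pfg.
apply: (@filterS3 _ _ (ae_filter_ringOfSetsType mu)) => x dm dg df Jx.
have [_ <-] := dm Jx.
have /= [_ ->] := is_deriveM (df Jx) (dg Jx).
by rewrite -[f x *: k x]/(f x * k x) -[g x *: h x]/(g x * h x); ring.
Qed.

End primitive_theory.

(** * Linear systems with integrable coefficients *)

Section real_dominated_convergence.
Context d (T : measurableType d) {R : realType} (m : {measure set T -> \bar R}).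

Lemma Rintegral_dominated_convergence (D : set T) (u : nat -> T -> R)
    (v g : T -> R) : measurable D ->
  (forall n, measurable_fun D (u n)) ->
  (forall x, D x -> u ^~ x @ \oo --> v x) ->
  m.-integrable D (EFin \o g) ->
  (forall n x, D x -> `|u n x| <= g x) ->
  m.-integrable D (EFin \o v) /\
  (\int[m]_(x in D) u n x) @[n --> \oo] --> \int[m]_(x in D) v x.
Proof.
move=> mD mu uv ig ug.
have mv : measurable_fun D v by exact: (measurable_fun_cvg mu uv).
have cv x : D x -> ((u n x)%:E) @[n --> \oo] --> (v x)%:E.
  by move=> Dx; apply: cvg_EFin; [exact: nearW|exact: uv].
have ugE n x : D x -> (`|(u n x)%:E| <= (g x)%:E)%E.
  by move=> Dx; rewrite lee_fin; exact: ug.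
have [iv _ cvI] := @dominated_convergence _ _ _ m D mD (fun n x => (u n x)%:E)
  (EFin \o v) (EFin \o g) (fun n => (measurable_EFinP _ _).2 (mu n))
  ((measurable_EFinP _ _).2 mv) (aeW _ cv) ig (aeW _ (fun x n => @ugE n x)).
split=> //; rewrite /Rintegral.
by apply: fine_cvg; rewrite fineK//; exact: integrable_fin_num.
Qed.

End real_dominated_convergence.

Section linear_ode.
Context {R : realType} (I : finType).
Local Notation mu := (@lebesgue_measure R).
Variables (a b : R).
Hypothesis ab : a < b.
Local Notation J := (`]a, b[%classic : set R).
Variables (A : I -> I -> R -> R) (f : I -> R -> R) (c : I -> R).
Hypothesis iA : forall i j, mu.-integrable J (EFin \o A i j).
Hypothesis jf : forall i, mu.-integrable J (EFin \o f i).

Let ri (u : R -> R) := mu.-integrable J (EFin \o u).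

Let ri_sum (u : I -> R -> R) : (forall i, ri (u i)) -> ri (fun x => \sum_i u i x).
Proof.
move=> iu; rewrite /ri.
have -> : EFin \o (fun x => \sum_i u i x) = (fun x => \sum_i (EFin \o u i) x)%E.
  by apply/funext => x; rewrite /= sumEFin.
by apply: integrable_sum => // i _; exact: iu.
Qed.

Let rhs (Y : I -> R -> R) i x := \sum_j A i j x * Y j x + f i x.

Let riD u v : ri u -> ri v -> ri (fun x => u x + v x).
Proof.
move=> iu iv; have := integrable_lin 1 1 iu iv.
by congr (_.-integrable _ (_ \o _)); apply/funext => t; rewrite !mul1r.
Qed.

Let ri_norm u : ri u -> ri (fun x => `|u x|).
Proof. exact: integrable_norm. Qed.

Let ri_rhs Y i : (forall j, abs_continuous a b (Y j)) -> ri (rhs Y i).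
Proof.
move=> acY; apply: (riD (u := fun x => \sum_j A i j x * Y j x) _ (jf i)).
apply: (ri_sum (u := fun j x => A i j x * Y j x)) => j.
exact: integrable_mul_bounded.
Qed.

Fixpoint picard n : I -> R -> R :=
  if n is n'.+1 then
    fun i x => c i + \int[mu]_(t in `]a, x[) rhs (picard n') i t
  else fun i x => c i.

Let picard_ac n i : abs_continuous a b (picard n i).
Proof.
elim: n i => [|n ih] i /=.
  move=> e e0; exists 1 => // l _ _.
  by rewrite /total_jump big1// => u _; rewrite subrr normr0.
have := primitive_integral (c i) (ri_rhs i ih).
exact: primitive_abs_continuous.
Qed.

Let picard_primitive n i : primitive a b (rhs (picard n) i) (picard n.+1 i).
Proof. exact: primitive_integral (ri_rhs i (picard_ac n)). Qed.

Let picard_a n i : picard n i a = c i.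
Proof.
by case: n => [//|n] /=; rewrite set_itvoo0 ?lexx// Rintegral_set0 addr0.
Qed.

Let incr n i x := picard n.+1 i x - picard n i x.

(** The sum of all entries bounds every row sum, so that the single scalar function [m] controls all
    components. *)
Let w x := \sum_i \sum_j `|A i j x|.

Let iw : ri w. 
Proof.
apply: (ri_sum (u := fun i x => \sum_j `|A i j x|)) => i.
apply: (ri_sum (u := fun j x => `|A i j x|)) => j; exact: ri_norm (iA i j).
Qed.

Let m x := \int[mu]_(t in `]a, x[) w t.

Let w_ge0 x : 0 <= w x. Proof. by rewrite sumr_ge0// => i _; rewrite sumr_ge0. Qed.

Let m_ge0 x : 0 <= m x. Proof. exact: Rintegral_ge0. Qed.

Let pm : primitive a b w m.
Proof.
have := primitive_integral 0 iw.
by congr primitive; apply/funext => x; rewrite add0r.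
Qed.

(** [exp_coeff (m x) n] is m^n / n!, so integrating w against one term of the exponential series
    yields the next. This gives factorial decay of the Picard increments on the whole interval, with
    no smallness of w. *)
Let pm_exp n : primitive a b (fun x => w x * exp_coeff (m x) n)
  (fun x => exp_coeff (m x) n.+1).
Proof.
elim: n => [|n ih].
  have := pm; congr primitive; apply/funext => x.
    by rewrite /exp_coeff /= expr0 fact0 divr1 mulr1.
  by rewrite /exp_coeff /= expr1 (_ : 1`! = 1)%N// divr1.
have := primitive_lin (n.+2%:R^-1) 0 (primitive_mul ab ih pm) pm.
have facE k : (k.+1)`!%:R = k.+1%:R * (k`!)%:R :> R by rewrite factS natrM.
have f0 k : (k`!)%:R != 0 :> R by rewrite pnatr_eq0 -lt0n fact_gt0.
have n0 k : k.+1%:R != 0 :> R by rewrite pnatr_eq0.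
have n1 : 1 + n%:R != 0 :> R by rewrite addrC natr1.
have n2 : 1 + n%:R + 1 != 0 :> R by rewrite [1 + _]addrC !natr1.
have n2' : 2 + n%:R != 0 :> R by rewrite addrC -natrD addn2.
have SS : n.+2%:R = n.+1%:R + 1 :> R by rewrite -natr1.
congr primitive; apply/funext => x; rewrite /exp_coeff /=.
  rewrite !facE exprS mul0r addr0 SS; field.
  by rewrite f0 n1 n2.
rewrite !facE exprS [in RHS]exprS [in RHS]exprS mul0r addr0; field.
by rewrite f0 n1 n2'.
Qed.

Let incr0_bound : exists2 C, 0 <= C & forall i x, x \in `[a, b] -> `|incr 0 i x| <= C.
Proof.
have H i : {M | 0 <= M /\ forall x, x \in `[a, b] -> `|incr 0 i x| <= M}.
  apply: cid; have [M M0 MP] := abs_continuous_bounded ab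
    (abs_continuousB (picard_ac 1 i) (picard_ac 0 i)).
  by exists M.
exists (\sum_i sval (H i)).
  by rewrite sumr_ge0// => i _; have [] := svalP (H i).
move=> i x xab; have [_ /(_ x xab) h] := svalP (H i).
apply: (le_trans h); rewrite (bigD1 i)//= lerDl sumr_ge0// => k _.
by have [] := svalP (H k).
Qed.

(** Consecutive iterates share the initial value and the inhomogeneity; both cancel, and only the
    linear part remains. *)
Let incrS n i x : x \in `[a, b] ->
  incr n.+1 i x = \int[mu]_(t in `]a, x[) (\sum_j A i j t * incr n j t).
Proof.
have := primitive_lin 1 (-1) (picard_primitive n.+1 i) (picard_primitive n i).
move=> [_ /[apply]]; rewrite !picard_a !mul1r !mulN1r subrr add0r.
rewrite -/(incr n.+1 i x) => ->; apply: eq_Rintegral => t _.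
rewrite /rhs mul1r mulN1r opprD addrACA subrr addr0 -sumrN -big_split /=.
by apply: eq_bigr => j _; rewrite -mulrBr.
Qed.

Let sub_itv x y : x \in `[a, b] -> `]a, x[%classic y -> y \in `[a, b] /\ J y.
Proof.
rewrite /= !in_itv /= => /andP[_ xb] /andP[ay yx].
by rewrite (ltW ay) ay (ltW (lt_le_trans yx xb)) (lt_le_trans yx xb).
Qed.

Let incr_bound C : (forall i x, x \in `[a, b] -> `|incr 0 i x| <= C) ->
  forall n i x, x \in `[a, b] -> `|incr n i x| <= C * exp_coeff (m x) n.
Proof.
move=> C0; elim=> [|n ih] i x xab.
  by rewrite /exp_coeff /= expr0 fact0 divr1 mulr1 C0.
have xb : x <= b by move: xab; rewrite in_itv => /andP[].
have iS u : ri u -> mu.-integrable `]a, x[ (EFin \o u).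
  by apply: integrableS => //; exact: subJ.
have iAi j : ri (fun t => A i j t * incr n j t).
  by apply: integrable_mul_bounded => //; exact: abs_continuousB.
rewrite incrS//.
apply: le_trans (le_normr_Rintegral _ (iS _ (ri_sum iAi))) _ => //.
have [_ /(_ x xab)] := primitive_lin C 0 (pm_exp n) (pm_exp n).
have ma : m a = 0 by rewrite /m set_itvoo0 ?lexx// Rintegral_set0.
rewrite !mul0r !addr0 ma {2}/exp_coeff /= expr0n /= mul0r mulr0 add0r => ->.
apply: le_Rintegral => //.
- by apply: iS; exact: ri_norm (ri_sum iAi).
- by apply: iS; have [] := primitive_lin C 0 (pm_exp n) (pm_exp n).
move=> t tx; have [tab _] := sub_itv xab tx.
rewrite mul0r addr0; apply: (le_trans (ler_norm_sum _ _ _)).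
apply: (@le_trans _ _ ((\sum_j `|A i j t|) * (C * exp_coeff (m t) n))).
  by rewrite mulr_suml ler_sum// => j _; rewrite normrM ler_wpM2l// ih.
rewrite mulrCA ler_wpM2l//; first exact: le_trans (C0 i t tab).
rewrite ler_wpM2r ?exp_coeff_ge0// /w [leRHS](bigD1 i)//= lerDl sumr_ge0// => k _.
by rewrite sumr_ge0.
Qed.

Lemma linear_ode_solution : exists Y : I -> R -> R, forall i,
  Y i a = c i /\ primitive a b (fun x => \sum_j A i j x * Y j x + f i x) (Y i).
Proof.
have [C C0 CP] := incr0_bound; have incrP := incr_bound CP.
(* As the integral of w >= 0, [m] is nondecreasing, so its value at b makes the bounds uniform on
   [a, b]. *)
have mle x : x \in `[a, b] -> m x <= m b.
  move=> xab; have bab : b \in `[a, b] by rewrite in_itv /= lexx ltW.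
  have xb : x <= b by move: xab; rewrite in_itv => /andP[].
  have ax : a <= x by move: xab; rewrite in_itv => /andP[].
  rewrite -subr_ge0 (primitive_sub pm)//.
  by apply: Rintegral_ge0 => t _; rewrite patchE; case: ifP.
have incrM n i x : x \in `[a, b] -> `|incr n i x| <= C * exp_coeff (m b) n.
  move=> xab; apply: (le_trans (incrP n i x xab)); rewrite ler_wpM2l//.
  by rewrite /exp_coeff /= ler_wpM2r// lerXn2r ?nnegrE ?m_ge0// mle.
have cvC : cvgn (series (fun n => C * exp_coeff (m b) n)).
  exact: (is_cvg_seriesZ (k := C) (is_cvg_series_exp_coeff (m b))).
have picardE n i x : picard n i x = c i + series (fun k => incr k i x) n.
  by rewrite /series /= /incr telescope_sumr// addrC subrK.
have cvY i x : x \in `[a, b] -> cvgn ((fun n => picard n i x)).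
  move=> xab; have -> : (fun n => picard n i x) = (fun n => c i + series (fun k => incr k i x) n).
    by apply/funext => n; exact: picardE.
  apply: is_cvgD; first exact: is_cvg_cst.
  apply: normed_cvg; apply: series_le_cvg cvC => n /=; [by []| |exact: incrM].
  by rewrite mulr_ge0// exp_coeff_ge0.
pose S := limn (series (fun n => C * exp_coeff (m b) n)).
pose B := \sum_i `|c i| + S.
have YB n i x : x \in `[a, b] -> `|picard n i x| <= B.
  move=> xab; rewrite picardE (le_trans (ler_normD _ _))// lerD//.
    by rewrite (bigD1 i)//= lerDl sumr_ge0.
  apply: (le_trans (ler_norm_sum _ _ _)).
  apply: (@le_trans _ _ (series (fun n => C * exp_coeff (m b) n) n)).
    by rewrite /series /= ler_sum// => k _; exact: incrM.
  apply: nondecreasing_cvgn_le => //.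
  apply: nondecreasing_series => k _ _.
  by rewrite mulr_ge0// exp_coeff_ge0.
pose Y i x := limn ((fun n => picard n i x)).
have rhsY i x : x \in `[a, b] -> (rhs (picard n) i x) @[n --> \oo] --> rhs Y i x.
  move=> xab; apply: cvgD; last exact: cvg_cst.
  elim: (index_enum I) => [|j s ih].
    by under eq_fun do rewrite big_nil; rewrite big_nil; exact: cvg_cst.
  under eq_fun do rewrite big_cons; rewrite big_cons.
  apply: cvgD => //; apply: cvgM; first exact: cvg_cst.
  exact: cvY.
(* The uniform bound B on the iterates gives an integrable majorant independent of n; dominated
   convergence then passes to the limit in the Picard recursion. *)
have dom i n x : x \in `[a, b] -> `|rhs (picard n) i x| <= w x * B + `|f i x|.
  move=> xab; rewrite (le_trans (ler_normD _ _))// lerD//.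
  apply: (le_trans (ler_norm_sum _ _ _)).
  have B0 : 0 <= B by exact: le_trans (YB 0 i x xab).
  apply: (@le_trans _ _ ((\sum_j `|A i j x|) * B)).
    by rewrite mulr_suml ler_sum// => j _; rewrite normrM ler_wpM2l// YB.
  rewrite ler_wpM2r// /w [leRHS](bigD1 i)//= lerDl sumr_ge0// => k _.
  by rewrite sumr_ge0.
have idom i : ri (fun x => w x * B + `|f i x|).
  have := integrable_lin B 1 iw (ri_norm (jf i)).
  by congr (_.-integrable _ (_ \o _)); apply/funext => t; rewrite mul1r mulrC.
have mrhs n i : measurable_fun J (rhs (picard n) i).
  by have /measurable_int/measurable_EFinP := ri_rhs i (picard_ac n).
have J_itv x : J x -> x \in `[a, b].
  by rewrite /= !in_itv /= => /andP[/ltW -> /ltW ->].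
have dct i x : x \in `[a, b] ->
    (\int[mu]_(t in `]a, x[) rhs (picard n) i t) @[n --> \oo] -->
    \int[mu]_(t in `]a, x[) rhs Y i t.
  move=> xab; have xb : x <= b by move: xab; rewrite in_itv => /andP[].
  have H1 n : measurable_fun `]a, x[ (rhs (picard n) i).
    by apply: measurable_funS (mrhs n i) => //; exact: subJ.
  have H2 t : `]a, x[%classic t -> (rhs (picard n) i t) @[n --> \oo] --> rhs Y i t.
    by move=> /(sub_itv xab)[tab _]; exact: rhsY.
  have H3 : mu.-integrable `]a, x[ (EFin \o (fun x => w x * B + `|f i x|)).
    by apply: integrableS (idom i) => //; exact: subJ.
  have H4 n t : `]a, x[%classic t -> `|rhs (picard n) i t| <= w t * B + `|f i t|.
    by move=> /(sub_itv xab)[tab _]; exact: dom.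
  by have [] := @Rintegral_dominated_convergence _ (measurableTypeR R) R mu
    _ _ _ _ (measurable_itv _) H1 H2 H3 H4.
have Ya i : Y i a = c i.
  rewrite /Y; have -> : (fun n => picard n i a) = (fun=> c i).
    by apply/funext => n; exact: picard_a.
  exact: lim_cst.
exists Y => i; split=> //; split.
  have H2 t : J t -> (rhs (picard n) i t) @[n --> \oo] --> rhs Y i t.
    by move=> /J_itv tab; exact: rhsY.
  have H4 n t : J t -> `|rhs (picard n) i t| <= w t * B + `|f i t|.
    by move=> /J_itv tab; exact: dom.
  by have [] := @Rintegral_dominated_convergence _ (measurableTypeR R) R mu
    _ _ _ _ (measurable_itv _)
    (fun n => mrhs n i) H2 (idom i) H4.
move=> x xab; rewrite Ya; apply/cvg_lim => //; rewrite -cvg_shiftS /=.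
by apply: cvgD; [exact: cvg_cst|exact: dct].
Qed.

End linear_ode.

(** * The Hilbert space L_2 *)

Section complex_integral.
Context {R : realType} (a b : R).
Local Notation mu := (@lebesgue_measure R).
Local Notation C := R[i].
Local Notation re := (@complex.Re R).
Local Notation im := (@complex.Im R).
Local Notation J := (`]a, b[%classic : set R).
Implicit Types F G : R -> C.

Definition cintegrable F :=
  mu.-integrable J (EFin \o (re \o F)) /\ mu.-integrable J (EFin \o (im \o F)).

Definition cintegral F : C :=
  Complex (\int[mu]_(x in J) re (F x)) (\int[mu]_(x in J) im (F x)).

Lemma Rintegral_lin (c d : R) (h k : R -> R) : mu.-integrable J (EFin \o h) ->
  mu.-integrable J (EFin \o k) ->
  \int[mu]_(x in J) (c * h x + d * k x) =
  c * \int[mu]_(x in J) h x + d * \int[mu]_(x in J) k x.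
Proof.
move=> ih ik.
have iZ r u : mu.-integrable J (EFin \o u) ->
    mu.-integrable J (EFin \o (fun t => r * u t)).
  move=> iu; have := integrable_lin r 0 iu iu.
  by congr (_.-integrable _ (_ \o _)); apply/funext => t; rewrite mul0r addr0.
by rewrite RintegralD ?RintegralZl//; exact: iZ.
Qed.

Lemma ae_eq_Rintegral (h k : R -> R) : measurable_fun J h -> measurable_fun J k ->
  {ae mu, forall x, J x -> h x = k x} ->
  \int[mu]_(x in J) h x = \int[mu]_(x in J) k x.
Proof.
move=> mh mk hk; congr fine; apply: ae_eq_integral => //.
- exact/measurable_EFinP.
- exact/measurable_EFinP.
apply: filterS hk; first exact: (ae_filter_ringOfSetsType mu).
by move=> x hkx /hkx /= ->.
Qed.

Lemma cintegrable_measurable F : cintegrable F ->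
  measurable_fun J (re \o F) /\ measurable_fun J (im \o F).
Proof. by move=> [/measurable_int/measurable_EFinP ? /measurable_int/measurable_EFinP]. Qed.

Lemma cintegrable_lin (c : C) F G : cintegrable F -> cintegrable G ->
  cintegrable (fun x => c * F x + G x).
Proof.
move=> [Fr Fi] [Gr Gi]; split.
  have := integrable_lin 1 1 (integrable_lin (re c) (- im c) Fr Fi) Gr.
  congr (_.-integrable _ (_ \o _)); apply/funext => t /=.
  by case: c (F t) (G t) => [c1 c2] [f1 f2] [g1 g2] /=; rewrite !mul1r mulNr.
have := integrable_lin 1 1 (integrable_lin (re c) (im c) Fi Fr) Gi.
congr (_.-integrable _ (_ \o _)); apply/funext => t /=.
by case: c (F t) (G t) => [c1 c2] [f1 f2] [g1 g2] /=; rewrite !mul1r.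
Qed.

Lemma cintegral_lin (c : C) F G : cintegrable F -> cintegrable G ->
  cintegral (fun x => c * F x + G x) = c * cintegral F + cintegral G.
Proof.
move=> [Fr Fi] [Gr Gi]; rewrite /cintegral; case: c => c1 c2.
have -> : (fun x => re (Complex c1 c2 * F x + G x)) =
    (fun x => 1 * (c1 * re (F x) + (- c2) * im (F x)) + 1 * re (G x)).
  apply/funext => t; case: (F t) (G t) => [f1 f2] [g1 g2] /=.
  by rewrite !mul1r mulNr.
have -> : (fun x => im (Complex c1 c2 * F x + G x)) =
    (fun x => 1 * (c1 * im (F x) + c2 * re (F x)) + 1 * im (G x)).
  apply/funext => t; case: (F t) (G t) => [f1 f2] [g1 g2] /=.
  by rewrite !mul1r.
rewrite (Rintegral_lin _ _ (integrable_lin c1 (- c2) Fr Fi) Gr).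
rewrite (Rintegral_lin _ _ (integrable_lin c1 c2 Fi Fr) Gi).
rewrite (Rintegral_lin _ _ Fr Fi) (Rintegral_lin _ _ Fi Fr).
by rewrite !mul1r mulNr; apply/eqP; rewrite eq_complex /= !eqxx.
Qed.

Lemma ae_eq_cintegral F G :
  measurable_fun J (re \o F) -> measurable_fun J (im \o F) ->
  measurable_fun J (re \o G) -> measurable_fun J (im \o G) ->
  {ae mu, forall x, J x -> F x = G x} -> cintegral F = cintegral G.
Proof.
move=> Fr Fi Gr Gi FG; congr Complex; apply: ae_eq_Rintegral => //;
  (apply: filterS FG; first exact: (ae_filter_ringOfSetsType mu));
  by move=> x FGx /FGx ->.
Qed.

Lemma square_integrableE F : F \in square_integrable a b <->
  [/\ measurable_fun J (re \o F), measurable_fun J (im \o F),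
    mu.-integrable J (EFin \o (fun x => re (F x) ^+ 2)) &
    mu.-integrable J (EFin \o (fun x => im (F x) ^+ 2))].
Proof.
split=> [/asboolP[mr mi fin]|[mr mi ir ii]].
  have iF : mu.-integrable J (fun x => (Normc.normc (F x) ^+ 2)%:E).
    apply/integrableP; split; first exact: measurable_sqnormc.
    by under eq_integral do rewrite gee0_abs ?lee_fin ?sqr_ge0//.
  split=> //; (apply: (le_integrable _ _ _ iF) => //;
    [by apply/measurable_EFinP; apply: measurable_funX|]);
    move=> x _ /=; rewrite lee_fin !ger0_norm ?sqr_ge0// sqnormc.
    by rewrite lerDl sqr_ge0.
  by rewrite lerDr sqr_ge0.
apply/asboolP; split=> //.
have := integrable_lin 1 1 ir ii => /integrableP[_]; apply: le_lt_trans.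
apply: ge0_le_integral => //.
- by move=> x _; rewrite lee_fin sqr_ge0.
- exact: measurable_sqnormc.
- apply: measurableT_comp => //; apply/measurable_EFinP.
  by apply: measurable_funD; apply: measurable_funM => //; apply: measurable_funX.
- by move=> x _ /=; rewrite lee_fin sqnormc !mul1r ler_norm.
Qed.

Lemma integrable_mul_square (u v : R -> R) :
  measurable_fun J u -> measurable_fun J v ->
  mu.-integrable J (EFin \o (fun x => u x ^+ 2)) ->
  mu.-integrable J (EFin \o (fun x => v x ^+ 2)) ->
  mu.-integrable J (EFin \o (fun x => u x * v x)).
Proof.
move=> mu_ mv iu iv; apply: (le_integrable _ _ _ (integrable_lin 1 1 iu iv)) => //.
  by apply/measurable_EFinP; exact: measurable_funM.
move=> x _ /=; rewrite lee_fin !mul1r [leRHS]ger0_norm ?addr_ge0 ?sqr_ge0//.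
rewrite -[u x ^+ 2]real_normK ?num_real// -[v x ^+ 2]real_normK ?num_real//.
by rewrite normrM; nra.
Qed.

Lemma cintegrable_mul_conj F G :
  F \in square_integrable a b -> G \in square_integrable a b ->
  cintegrable (fun x => F x * (G x)^*%C).
Proof.
move=> /square_integrableE[Fr Fi Fr2 Fi2] /square_integrableE[Gr Gi Gr2 Gi2].
split.
  have := integrable_lin 1 1 (integrable_mul_square Fr Gr Fr2 Gr2)
    (integrable_mul_square Fi Gi Fi2 Gi2).
  congr (_.-integrable _ (_ \o _)); apply/funext => t /=.
  by case: (F t) (G t) => [f1 f2] [g1 g2] /=; ring.
have := integrable_lin 1 (-1) (integrable_mul_square Fi Gr Fi2 Gr2)
  (integrable_mul_square Fr Gi Fr2 Gi2).
congr (_.-integrable _ (_ \o _)); apply/funext => t /=.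
by case: (F t) (G t) => [f1 f2] [g1 g2] /=; ring.
Qed.

End complex_integral.

Section L2_theory.
Context {R : realType} (a b : R).
Local Notation mu := (@lebesgue_measure R).
Local Notation C := R[i].
Local Notation re := (@complex.Re R).
Local Notation im := (@complex.Im R).
Local Notation J := (`]a, b[%classic : set R).
Local Notation H := (L2 a b).
Implicit Types (u v w : H) (F G : R -> C).
Local Open Scope quotient_scope.

Lemma L2_square_integrable u : (u : R -> C) \in square_integrable a b.
Proof. exact: L2funP. Qed.

Lemma L2_pi_ae (f : L2fun a b) :
  {ae mu, forall x, J x -> (\pi_H f : H) x = f x}.
Proof.
have : (repr (\pi_H f : H) - f) \in @Defs.null_fun R a b.
  by rewrite Quotient.idealrBE reprK.
move=> /asboolP; apply: filterS; first exact: (ae_filter_ringOfSetsType mu).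
by move=> x h /h h0; apply/eqP; rewrite -subr_eq0; apply/eqP.
Qed.

Lemma L2_eq_ae u v : {ae mu, forall x, J x -> u x = v x} -> u = v.
Proof.
move=> uv; rewrite -[u]reprK -[v]reprK; apply/eqP; rewrite -Quotient.idealrBE.
apply/asboolP; apply: filterS uv; first exact: (ae_filter_ringOfSetsType mu).
by move=> x h /h h0; apply/eqP; rewrite [_ x]/(u x - v x) subr_eq0; apply/eqP.
Qed.

(** The choice of representatives is not linear, so the pointwise formula is only available almost
    everywhere. *)
Lemma L2_lin_ae c u v : {ae mu, forall x, J x -> (c *: u + v : H) x = c * u x + v x}.
Proof.
have -> : c *: u + v = \pi_H (c *: repr u + repr v).
  by rewrite raddfD /= reprK pi_L2scale reprK.
exact: L2_pi_ae.
Qed.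

Definition L2_of F (hF : F \in square_integrable a b) : H := \pi_H (MkL2fun hF).

Lemma L2_of_ae F (hF : F \in square_integrable a b) :
  {ae mu, forall x, J x -> L2_of hF x = F x}.
Proof. exact: L2_pi_ae. Qed.

Lemma L2dot_cintegrable u v : cintegrable a b (fun x => u x * (v x)^*%C).
Proof. by apply: cintegrable_mul_conj; exact: L2_square_integrable. Qed.

Lemma L2dot_linl c u v w : L2dot (c *: u + v) w = c * L2dot u w + L2dot v w.
Proof.
have I1 := L2dot_cintegrable u w; have I2 := L2dot_cintegrable v w.
rewrite -[c * _ + _](cintegral_lin c I1 I2).
have [Fr Fi] := cintegrable_measurable (L2dot_cintegrable (c *: u + v) w).
have [Gr Gi] := cintegrable_measurable (cintegrable_lin c I1 I2).
apply: ae_eq_cintegral => //.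
apply: filterS (L2_lin_ae c u v); first exact: (ae_filter_ringOfSetsType mu).
by move=> x h /h ->; rewrite mulrDl mulrA.
Qed.

Lemma L2dotC u v : L2dot v u = (L2dot u v)^*%C.
Proof.
rewrite /L2dot /=; congr Complex.
  apply: eq_Rintegral => x _; case: (u x) (v x) => [u1 u2] [v1 v2] /=.
  by ring.
have [_ ii] := L2dot_cintegrable u v.
have := Rintegral_lin (-1) 0 ii ii; rewrite mul0r addr0 mulN1r => <-.
apply: eq_Rintegral => x _ /=; case: (u x) (v x) => [u1 u2] [v1 v2] /=.
by ring.
Qed.

Lemma conjcD (x y : C) : (x + y)^*%C = x^*%C + y^*%C.
Proof. by case: x y => [? ?] [? ?] /=; rewrite opprD. Qed.

Lemma conjcM (x y : C) : (x * y)^*%C = x^*%C * y^*%C.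
Proof.
by case: x y => [x1 x2] [y1 y2]; apply/eqP; rewrite eq_complex /=;
  apply/andP; split; apply/eqP; ring.
Qed.

Lemma conjc_conj (x : C) : (x^*%C)^*%C = x.
Proof. by case: x => ? ? /=; rewrite opprK. Qed.

Lemma L2dot_linr c u v w : L2dot w (c *: u + v) = c^*%C * L2dot w u + L2dot w v.
Proof. by rewrite L2dotC L2dot_linl conjcD conjcM -!L2dotC. Qed.

Lemma L2dotDl u v w : L2dot (u + v) w = L2dot u w + L2dot v w.
Proof. by rewrite -[u]scale1r L2dot_linl mul1r scale1r. Qed.

Lemma L2dotDr u v w : L2dot w (u + v) = L2dot w u + L2dot w v.
Proof. by rewrite L2dotC L2dotDl conjcD -!L2dotC. Qed.

Lemma L2dot0l w : L2dot 0 w = 0.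
Proof. by apply: (addrI (L2dot 0 w)); rewrite -L2dotDl !addr0. Qed.

Lemma L2dot0r w : L2dot w 0 = 0.
Proof. by apply: (addrI (L2dot w 0)); rewrite -L2dotDr !addr0. Qed.

Lemma L2dotZl c u w : L2dot (c *: u) w = c * L2dot u w.
Proof. by rewrite -[c *: u]addr0 L2dot_linl L2dot0l addr0. Qed.

Lemma L2dotZr c u w : L2dot w (c *: u) = c^*%C * L2dot w u.
Proof. by rewrite -[c *: u]addr0 L2dot_linr L2dot0r addr0. Qed.

Lemma L2dotNl u w : L2dot (- u) w = - L2dot u w.
Proof. by rewrite -scaleN1r L2dotZl mulN1r. Qed.

Lemma L2dotNr u w : L2dot w (- u) = - L2dot w u.
Proof. by rewrite L2dotC L2dotNl; rewrite [in RHS]L2dotC; case: (L2dot u w). Qed.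

Definition L2sq u : R := re (L2dot u u).

Lemma L2dotxx u : L2dot u u = (L2sq u)%:C%C.
Proof.
rewrite /L2sq; have := L2dotC u u; case: (L2dot u u) => x y /= [] h.
have -> : y = 0 by move: h; lra.
by [].
Qed.

Lemma L2sqE u : L2sq u =
  \int[mu]_(x in J) (re (u x) ^+ 2) + \int[mu]_(x in J) (im (u x) ^+ 2).
Proof.
have [_ _ ir ii] := (square_integrableE a b _).1 (L2_square_integrable u).
have := Rintegral_lin 1 1 ir ii; rewrite !mul1r => <-.
rewrite /L2sq /L2dot /=; apply: eq_Rintegral => x _.
by case: (u x) => [u1 u2] /=; ring.
Qed.

Lemma L2sq_ge0 u : 0 <= L2sq u.
Proof. by rewrite L2sqE addr_ge0// Rintegral_ge0// => x _; exact: sqr_ge0. Qed.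

Lemma Rintegral_sqr_eq0 (f : R -> R) :
  mu.-integrable J (EFin \o (fun x => f x ^+ 2)) ->
  \int[mu]_(x in J) (f x ^+ 2) = 0 -> {ae mu, forall x, J x -> f x = 0}.
Proof.
move=> fi f0; have /measurable_int mf := fi.
have : (\int[mu]_(x in J) `|(f x ^+ 2)%:E|)%E = 0%E.
  under eq_integral do rewrite gee0_abs ?lee_fin ?sqr_ge0//.
  by rewrite -[LHS]fineK ?[fine _]f0//; exact: integrable_fin_num.
move=> I0; have h0 : {ae mu, forall x, J x -> (f x ^+ 2)%:E = 0%E :> \bar R}.
  exact: (ae_eq_integral_abs mu (measurable_itv _) mf).1 I0.
move: h0.
apply: filterS; first exact: (ae_filter_ringOfSetsType mu).
by move=> x h /h [] /eqP; rewrite sqrf_eq0 => /eqP.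
Qed.

Lemma L2sq_eq0 u : L2sq u = 0 -> u = 0.
Proof.
move=> u0; have [_ _ ir ii] := (square_integrableE a b _).1 (L2_square_integrable u).
have r0 : 0 <= \int[mu]_(x in J) (re (u x) ^+ 2).
  by apply: Rintegral_ge0 => x _; exact: sqr_ge0.
have i0 : 0 <= \int[mu]_(x in J) (im (u x) ^+ 2).
  by apply: Rintegral_ge0 => x _; exact: sqr_ge0.
have /eqP := u0; rewrite L2sqE paddr_eq0// => /andP[/eqP ur /eqP ui].
have zero_ae : {ae mu, forall x, J x -> (0 : H) x = 0}.
  have := L2_lin_ae (-1) (0 : H) 0; rewrite scaler0 addr0.
  apply: filterS; first exact: (ae_filter_ringOfSetsType mu).
  by move=> x h /h ->; rewrite mulN1r addNr.
apply: L2_eq_ae.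
apply: (@filterS3 _ _ (ae_filter_ringOfSetsType mu) _ _ _ _ _
  (Rintegral_sqr_eq0 ir ur) (Rintegral_sqr_eq0 ii ui) zero_ae).
move=> x hr hi hz Jx; rewrite hz//; apply/eqP; rewrite eq_complex /=.
by rewrite hr// hi// !eqxx.
Qed.

Lemma L2_dot_self_eq0 u : L2dot u u = 0 -> u = 0.
Proof. by move=> u0; apply: L2sq_eq0; rewrite /L2sq u0. Qed.

End L2_theory.

(** * Sequences with geometrically decreasing increments *)

Section geometric_convergence.
Context {R : realType}.

(** The increments are at most 2^-n sqrt s, so the tail from n is at most twice that; squaring
    produces the factor 4. *)
Lemma geometric_increments_cvg (r : R^nat) (s : R) : 0 <= s ->
  (forall n, (r n.+1 - r n) ^+ 2 <= 4^-1 ^+ n * s) ->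
  cvgn r /\ forall n, (limn r - r n) ^+ 2 <= 4 * 4^-1 ^+ n * s.
Proof.
move=> s0 rs; pose t := Num.sqrt s; have t0 : 0 <= t by exact: sqrtr_ge0.
have tE : t ^+ 2 = s by exact: sqr_sqrtr.
have h4 n : (4^-1 : R) ^+ n = (2^-1 ^+ n) ^+ 2.
  by rewrite -exprM mulnC exprM; congr (_ ^+ _); field.
have p2 n : 0 <= (2^-1 : R) ^+ n by rewrite exprn_ge0// invr_ge0.
have rt n : `|r n.+1 - r n| <= t * 2^-1 ^+ n.
  rewrite -ler_sqr ?nnegrE ?mulr_ge0// real_normK ?num_real// (le_trans (rs n))//.
  by rewrite exprMn tE h4 mulrC.
have rE n : r n = r 0%N + series (fun k => r k.+1 - r k) n.
  by rewrite /series /= telescope_sumr// addrC subrK.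
have cr : cvgn r.
  have -> : r = (fun n => r 0%N + series (fun k => r k.+1 - r k) n).
    by apply/funext => n; exact: rE.
  apply: is_cvgD; first exact: is_cvg_cst.
  apply: normed_cvg; apply: (@series_le_cvg _ _ (geometric t 2^-1)) => //=.
  - by move=> n; rewrite mulr_ge0.
  - apply: is_cvg_geometric_series; rewrite ger0_norm ?invr_ge0//.
    by rewrite invf_lt1// ltr1n.
(* Keeping the exact geometric partial sum, with its factor 1 - 2^-m, lets the induction close; the
   factor is bounded by 1 afterwards. *)
have dist n m : `|r (m + n)%N - r n| <= t * 2^-1 ^+ n * 2 * (1 - 2^-1 ^+ m).
  elim: m => [|m ih]; first by rewrite add0n subrr normr0 expr0 subrr mulr0.
  have -> : r (m.+1 + n)%N - r n = (r (m + n).+1 - r (m + n)%N) + (r (m + n)%N - r n).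
    by rewrite addSn; ring.
  apply: (le_trans (ler_normD _ _)).
  apply: (le_trans (lerD (rt _) ih)).
  rewrite exprS exprD; set x := 2^-1 ^+ m; set y := 2^-1 ^+ n.
  by rewrite le_eqVlt; apply/orP; left; apply/eqP; field.
split=> // n.
have lim_le : `|limn r - r n| <= 2 * (t * 2^-1 ^+ n).
  have cn : `|r (m + n)%N - r n| @[m --> \oo] --> `|limn r - r n|.
    apply: cvg_norm; apply: cvgB; last exact: cvg_cst.
    by have := cr; rewrite -(cvg_shiftn n).
  rewrite -(cvg_lim _ cn)//; apply: limr_le.
    by apply/cvg_ex; eexists; exact: cn.
  apply: nearW => m; apply: (le_trans (dist n m)).
  by rewrite [leRHS]mulrC ler_piMr ?mulr_ge0// gerBl.
rewrite -real_normK ?num_real//.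
apply: (@le_trans _ _ ((2 * (t * 2^-1 ^+ n)) ^+ 2)).
  by rewrite ler_sqr ?nnegrE ?mulr_ge0.
by rewrite !exprMn tE h4 le_eqVlt; apply/orP; left; apply/eqP; ring.
Qed.

Lemma sqrB_le (x y : R) : (x - y) ^+ 2 <= 2 * x ^+ 2 + 2 * y ^+ 2.
Proof.
rewrite -subr_ge0; have -> : 2 * x ^+ 2 + 2 * y ^+ 2 - (x - y) ^+ 2 = (x + y) ^+ 2.
  by ring.
exact: sqr_ge0.
Qed.

Lemma sqr_le_subD (x y : R) : x ^+ 2 <= 2 * (x - y) ^+ 2 + 2 * y ^+ 2.
Proof.
have := sqrB_le (x - y) (- y); rewrite sqrrN opprK subrK; exact.
Qed.

Lemma sum_quarter_le n : \sum_(k < n) (4^-1 : R) ^+ k <= 2.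
Proof.
suff : \sum_(k < n) (4^-1 : R) ^+ k = 4 / 3 * (1 - 4^-1 ^+ n).
  move=> ->; have : 0 <= (4^-1 : R) ^+ n by rewrite exprn_ge0// invr_ge0.
  lra.
elim: n => [|n ih]; first by rewrite big_ord0 expr0 subrr mulr0.
by rewrite big_ord_recr /= ih exprS; field.
Qed.

End geometric_convergence.

(** * Completeness of L_2 *)

Section completeness.
Context {R : realType} (a b : R).
Local Notation mu := (@lebesgue_measure R).
Local Notation C := R[i].
Local Notation re := (@complex.Re R).
Local Notation im := (@complex.Im R).
Local Notation J := (`]a, b[%classic : set R).
Local Notation H := (L2 a b).

(* The weights 4^k make S = sum_k 4^k (v_(k+1) - v_k)^2 integrable, and
   (v_(k+1) - v_k)^2 <= 4^-k S holds pointwise. *)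
Lemma square_integrable_complete (v : nat -> R -> R) :
  (forall n, measurable_fun J (v n)) ->
  mu.-integrable J (EFin \o (fun x => v 0%N x ^+ 2)) ->
  (forall n, (\int[mu]_(x in J) ((v n.+1 x - v n x) ^+ 2)%:E <= (16^-1 ^+ n)%:E)%E) ->
  exists g : R -> R, [/\ measurable_fun J g,
    mu.-integrable J (EFin \o (fun x => g x ^+ 2)) &
    forall n, \int[mu]_(x in J) ((g x - v n x) ^+ 2) <= 8 * 4^-1 ^+ n].
Proof.
move=> mv i0 vle.
pose S (x : R) := (\sum_(k <oo) (4 ^+ k * (v k.+1 x - v k x) ^+ 2)%:E)%E.
have mt k : measurable_fun J (fun x => (4 ^+ k * (v k.+1 x - v k x) ^+ 2)%:E).
  apply/measurable_EFinP; apply: measurable_funM => //.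
  by apply: measurable_funX; apply: measurable_funB.
have t0 k x : (0 <= (4 ^+ k * (v k.+1 x - v k x) ^+ 2)%:E)%E.
  by rewrite lee_fin mulr_ge0 ?sqr_ge0// exprn_ge0.
have mS : measurable_fun J S by apply: ge0_emeasurable_sum.
have S0 x : (0 <= S x)%E by exact: nneseries_ge0.
have intS : (\int[mu]_(x in J) S x <= 2%:E)%E.
  rewrite integral_nneseries//.
  apply: lime_le; first by apply: is_cvg_nneseries => k _ _; exact: integral_ge0.
  apply: nearW => n; rewrite big_mkord.
  apply: (@le_trans _ _ (\sum_(k < n) (4^-1 ^+ k)%:E)%E); last first.
    by rewrite sumEFin lee_fin sum_quarter_le.
  apply: lee_sum => k _.
  under eq_integral do rewrite EFinM.
  rewrite ge0_integralZl//; last 2 first.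
  - apply/measurable_EFinP; apply: measurable_funX; exact: measurable_funB (mv _) (mv _).
  - by move=> x _; rewrite lee_fin sqr_ge0.
  apply: (@le_trans _ _ ((4 ^+ k)%:E * (16^-1 ^+ k)%:E)%E).
    by rewrite lee_pmul2l// ?lte_fin ?exprn_gt0.
  rewrite -EFinM -exprMn lee_fin.
  by have -> : (4 * 16^-1 : R) = 4^-1 by field.
have iS : mu.-integrable J S.
  apply/integrableP; split=> //.
  under eq_integral do rewrite gee0_abs//.
  exact: le_lt_trans intS (ltry _).
(* S may be infinite on a null set. Cutting all [v n] off to 0 there makes the limit g exist at
   every point, which gives its measurability. *)
pose E : set (measurableTypeR R) := J `&` [set x | (S x < +oo)%E].
have mE : measurable E by exact: emeasurable_fun_infty_o.
pose v' n := v n \_ E.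
have vE n x : x \in E -> v' n x = v n x by move=> xE; rewrite /v' patchE xE.
have vNE n x : x \notin E -> v' n x = 0.
  by move=> /negbTE xE; rewrite /v' patchE xE.
have mv' n : measurable_fun J (v' n).
  apply/measurable_restrict => //; apply: measurable_funS (mv n) => //.
have sE x : x \in E -> S x = (fine (S x))%:E.
  rewrite inE => -[_ /= Sx]; rewrite fineK// ge0_fin_numE//.
have Eae : {ae mu, forall x, J x -> x \in E}.
  have : {ae mu, forall x, J x -> S x \is a fin_num} by exact: integrable_ae.
  apply: filterS; first exact: (ae_filter_ringOfSetsType mu).
  by move=> x h Jx; rewrite inE; split=> //=; rewrite -ge0_fin_numE// h.
have geom x : x \in E -> cvgn (fun n => v n x) /\
    forall n, (limn (fun n => v n x) - v n x) ^+ 2 <= 4 * 4^-1 ^+ n * fine (S x).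
  move=> xE; apply: geometric_increments_cvg; first by rewrite fine_ge0.
  move=> n; rewrite exprVn mulrC ler_pdivlMr ?exprn_gt0// mulrC.
  rewrite -lee_fin -sE//.
  apply: (@le_trans _ _ (\sum_(0 <= k < n.+1) (4 ^+ k * (v k.+1 x - v k x) ^+ 2)%:E)%E).
    by rewrite big_nat_recr//= leeDr// sume_ge0.
  by apply: nneseries_lim_ge => k _ _; exact: t0.
pose g x := limn (fun n => v' n x).
have gE x : x \in E -> g x = limn (fun n => v n x).
  by move=> xE; rewrite /g; under eq_fun do rewrite vE//.
have gNE x : x \notin E -> g x = 0.
  by move=> xE; rewrite /g; under eq_fun do rewrite vNE//; exact: lim_cst.
have cv' x : cvgn (fun n => v' n x).
  have [xE|xE] := boolP (x \in E).
    by under eq_fun do rewrite vE//; have [] := geom x xE.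
  by under eq_fun do rewrite vNE//; exact: is_cvg_cst.
have mg : measurable_fun J g.
  by apply: (measurable_fun_cvg mv') => x _; exact: cv'.
have ifS : mu.-integrable J (EFin \o (fun x => fine (S x))).
  apply: (le_integrable _ _ _ iS) => //.
    by apply/measurable_EFinP; apply: measurableT_comp.
  move=> x Jx /=; have := S0 x; case: (S x) => [r| |] //= _.
  by rewrite normr0 leey.
have gv' n x : J x -> (g x - v' n x) ^+ 2 <= 4 * 4^-1 ^+ n * fine (S x).
  move=> Jx; have [xE|xE] := boolP (x \in E).
    by rewrite gE// vE//; have [_] := geom x xE.
  rewrite gNE// vNE// subrr expr0n /= !mulr_ge0 ?fine_ge0// ?exprn_ge0// ?invr_ge0.
have igv n : mu.-integrable J (EFin \o (fun x => (g x - v' n x) ^+ 2)).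
  apply: (le_integrable _ _ _ (integrable_lin (4 * 4^-1 ^+ n) 0 ifS ifS)) => //.
    apply/measurable_EFinP; apply: measurable_funX; exact: measurable_funB mg (mv' n).
  move=> x Jx /=; rewrite lee_fin mul0r addr0 !ger0_norm ?sqr_ge0 ?gv'//.
  exact: le_trans (sqr_ge0 _) (gv' n x Jx).
exists g; split=> //.
  apply: (le_integrable _ _ _ (integrable_lin 2 2 (igv 0%N) i0)) => //.
    by apply/measurable_EFinP; exact: measurable_funX.
  move=> x Jx /=; rewrite lee_fin ger0_norm ?sqr_ge0// ger0_norm; last first.
    by rewrite addr_ge0// mulr_ge0// sqr_ge0.
  have [xE|xE] := boolP (x \in E); first by rewrite vE// sqr_le_subD.
  by rewrite gNE// vNE// subrr expr0n /= mulr0 add0r mulr_ge0// sqr_ge0.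
move=> n; have -> : \int[mu]_(x in J) (g x - v n x) ^+ 2 =
    \int[mu]_(x in J) (g x - v' n x) ^+ 2.
  apply: ae_eq_Rintegral.
  - by apply: measurable_funX; exact: measurable_funB mg (mv n).
  - by apply: measurable_funX; exact: measurable_funB mg (mv' n).
  apply: filterS Eae; first exact: (ae_filter_ringOfSetsType mu).
  by move=> x h /h xE; rewrite vE.
(* The constant 8 is the 4 of the pointwise tail estimate times the bound 2 on the integral of S. *)
apply: (@le_trans _ _ (\int[mu]_(x in J) (4 * 4^-1 ^+ n * fine (S x)))).
  apply: le_Rintegral => //.
  have := integrable_lin (4 * 4^-1 ^+ n) 0 ifS ifS.
  by congr (_.-integrable _ (_ \o _)); apply/funext => t; rewrite mul0r addr0.
  exact: gv'.
rewrite RintegralZl//.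
have : \int[mu]_(x in J) fine (S x) <= 2.
  rewrite -lee_fin; apply: le_trans intS; rewrite /Rintegral fineK; last first.
    exact: integrable_fin_num.
  by apply: ge0_le_integral => //;
    [move=> x _; rewrite lee_fin fine_ge0|exact: measurable_int ifS|
     move=> x _; have := S0 x; case: (S x) => [r| |] //= _; rewrite ?leey].
have : 0 <= (4^-1 : R) ^+ n by rewrite exprn_ge0// invr_ge0.
nra.
Qed.

(** Only rapidly converging sequences are needed, because a minimizing sequence can be chosen that
    fast. Real and imaginary parts each contribute 8 to the constant 16. *)
Lemma L2_complete (u : nat -> H) :
  (forall n, L2sq (u n.+1 - u n) <= 16^-1 ^+ n) ->
  exists g : H, forall n, L2sq (g - u n) <= 16 * 4^-1 ^+ n.
Proof.
move=> ule.
have sub_ae (x y : H) : {ae mu, forall t, J t -> (x - y : H) t = x t - y t}.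
  have := L2_lin_ae (-1) y x; rewrite scaleN1r addrC.
  apply: filterS; first exact: (ae_filter_ringOfSetsType mu).
  by move=> t h /h ->; rewrite mulN1r addrC.
have sqP (x : H) := (square_integrableE a b _).1 (L2_square_integrable x).
have int_re (x y : H) : \int[mu]_(t in J) (re ((x - y : H) t) ^+ 2) =
    \int[mu]_(t in J) ((re (x t) - re (y t)) ^+ 2).
  have [? _ _ _] := sqP x; have [? _ _ _] := sqP y; have [? _ _ _] := sqP (x - y).
  apply: ae_eq_Rintegral.
  - exact: measurable_funX.
  - by apply: measurable_funX; exact: measurable_funB.
  apply: filterS (sub_ae x y); first exact: (ae_filter_ringOfSetsType mu).
  by move=> t h /h ->; case: (x t) (y t) => [? ?] [? ?].
have int_im (x y : H) : \int[mu]_(t in J) (im ((x - y : H) t) ^+ 2) =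
    \int[mu]_(t in J) ((im (x t) - im (y t)) ^+ 2).
  have [_ ? _ _] := sqP x; have [_ ? _ _] := sqP y; have [_ ? _ _] := sqP (x - y).
  apply: ae_eq_Rintegral.
  - exact: measurable_funX.
  - by apply: measurable_funX; exact: measurable_funB.
  apply: filterS (sub_ae x y); first exact: (ae_filter_ringOfSetsType mu).
  by move=> t h /h ->; case: (x t) (y t) => [? ?] [? ?].
have int_E (f h : R -> R) : measurable_fun J f -> measurable_fun J h ->
    mu.-integrable J (EFin \o (fun t => f t ^+ 2)) ->
    mu.-integrable J (EFin \o (fun t => h t ^+ 2)) ->
    (\int[mu]_(t in J) ((f t - h t) ^+ 2)%:E)%E =
    (\int[mu]_(t in J) ((f t - h t) ^+ 2))%:E.
  move=> mf mh if_ ih; rewrite /Rintegral fineK//; apply: integrable_fin_num => //.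
  apply: (le_integrable _ _ _ (integrable_lin 2 2 if_ ih)) => //.
    by apply/measurable_EFinP; apply: measurable_funX; exact: measurable_funB.
  move=> t _ /=; rewrite lee_fin ger0_norm ?sqr_ge0// ger0_norm; last first.
    by rewrite addr_ge0// mulr_ge0// sqr_ge0.
  exact: sqrB_le.
have [gr [mgr igr gru]] : exists g : R -> R, [/\ measurable_fun J g,
    mu.-integrable J (EFin \o (fun x => g x ^+ 2)) &
    forall n, \int[mu]_(x in J) ((g x - re (u n x)) ^+ 2) <= 8 * 4^-1 ^+ n].
  apply: square_integrable_complete => [n||n].
  - by have [] := sqP (u n).
  - by have [] := sqP (u 0%N).
  have [m1 _ i1 _] := sqP (u n.+1); have [m2 _ i2 _] := sqP (u n).
  rewrite int_E// lee_fin -int_re (le_trans _ (ule n))// L2sqE lerDl.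
  by apply: Rintegral_ge0 => x _; exact: sqr_ge0.
have [gi [mgi igi giu]] : exists g : R -> R, [/\ measurable_fun J g,
    mu.-integrable J (EFin \o (fun x => g x ^+ 2)) &
    forall n, \int[mu]_(x in J) ((g x - im (u n x)) ^+ 2) <= 8 * 4^-1 ^+ n].
  apply: square_integrable_complete => [n||n].
  - by have [] := sqP (u n).
  - by have [] := sqP (u 0%N).
  have [_ m1 _ i1] := sqP (u n.+1); have [_ m2 _ i2] := sqP (u n).
  rewrite int_E// lee_fin -int_im (le_trans _ (ule n))// L2sqE lerDr.
  by apply: Rintegral_ge0 => x _; exact: sqr_ge0.
pose G x := Complex (gr x) (gi x).
have hG : G \in square_integrable a b by apply/square_integrableE.
pose g := L2_of hG; exists g => n.
have [m1 m2 i1 i2] := sqP (u n); have [m3 m4 i3 i4] := sqP g.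
have gae := L2_of_ae hG.
have -> : L2sq (g - u n) = \int[mu]_(t in J) ((gr t - re (u n t)) ^+ 2) +
    \int[mu]_(t in J) ((gi t - im (u n t)) ^+ 2).
  rewrite L2sqE int_re int_im; congr (_ + _); apply: ae_eq_Rintegral.
  - by apply: measurable_funX; exact: measurable_funB.
  - by apply: measurable_funX; exact: measurable_funB.
  - apply: filterS gae; first exact: (ae_filter_ringOfSetsType mu).
    by move=> t h /h; rewrite -/g => ->.
  - by apply: measurable_funX; exact: measurable_funB.
  - by apply: measurable_funX; exact: measurable_funB.
  - apply: filterS gae; first exact: (ae_filter_ringOfSetsType mu).
    by move=> t h /h; rewrite -/g => ->.
by apply: (le_trans (lerD (gru n) (giu n))); lra.
Qed.

End completeness.

(** * Almost minimal vectors and density of subspaces *)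

Section orthogonal_projection.
Context {R : realType} (a b : R).
Local Notation C := R[i].
Local Notation re := (@complex.Re R).
Local Notation H := (L2 a b).
Implicit Types (x y u : H) (D : set H).

(** The squared modulus as a polynomial in the coordinates, so that estimates avoid square roots. *)
Definition csq (z : C) : R := re z ^+ 2 + complex.Im z ^+ 2.

Lemma csq_ge0 z : 0 <= csq z.
Proof. by rewrite addr_ge0 ?sqr_ge0. Qed.

Lemma csq_eq0 z : csq z <= 0 -> z = 0.
Proof.
move=> h; have /eqP : csq z = 0 by apply: le_anti; rewrite h csq_ge0.
rewrite paddr_eq0 ?sqr_ge0// !sqrf_eq0 => /andP[/eqP zr /eqP zi].
by apply/eqP; rewrite eq_complex zr zi !eqxx.
Qed.

Lemma csqD_le z w : csq (z + w) <= 2 * csq z + 2 * csq w.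
Proof.
case: z w => [z1 z2] [w1 w2]; rewrite /csq /=.
have := sqrB_le z1 (- w1); have := sqrB_le z2 (- w2).
rewrite !opprK !sqrrN; lra.
Qed.

Lemma L2sq_expand x u (s : R) :
  L2sq (x - (s%:C%C * L2dot x u) *: u) =
  L2sq x - 2 * s * csq (L2dot x u) + s ^+ 2 * csq (L2dot x u) * L2sq u.
Proof.
rewrite {1}/L2sq !(L2dotDl, L2dotDr, L2dotNl, L2dotNr, L2dotZl, L2dotZr).
rewrite (L2dotxx u) (L2dotxx x) (L2dotC x u) /csq.
by case: (L2dot x u) => d1 d2 /=; ring.
Qed.

(** A quantitative form of orthogonality at a minimum: x is minimal up to e along the line of u.
    With e the squared norm of x the assumption is automatic and the conclusion is Cauchy-Schwarz;
    with small e it applies to a minimizing sequence. *)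
Lemma L2_almost_minimal x u (e : R) :
  (forall c : C, L2sq x <= L2sq (x - c *: u) + e) ->
  csq (L2dot x u) <= e * L2sq u.
Proof.
move=> xmin; have {xmin} h s := xmin (s%:C%C * L2dot x u).
set d := csq (L2dot x u); have d0 : 0 <= d by exact: csq_ge0.
have {}h s : 2 * s * d <= e + s ^+ 2 * d * L2sq u.
  by have := h s; rewrite L2sq_expand -/d; lra.
have := L2sq_ge0 u; rewrite le_eqVlt => /predU1P[u0|u0].
  rewrite -u0 mulr0 leNgt; apply/negP => dp.
  (* For a null vector u the quadratic term disappears, and this s turns the inequality into e + 1
     <= e. *)
  have := h ((e + 1) / (2 * d)); rewrite -u0 mulr0 addr0.
  have -> : 2 * ((e + 1) / (2 * d)) * d = e + 1 by field; rewrite gt_eqF.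
  lra.
rewrite -ler_pdivrMr//.
(* The minimizer in s of the quadratic polynomial. *)
have := h (L2sq u)^-1.
have -> : (L2sq u)^-1 ^+ 2 * d * L2sq u = d / L2sq u by field; rewrite gt_eqF.
have -> : 2 * (L2sq u)^-1 * d = 2 * (d / L2sq u) by ring.
lra.
Qed.

Lemma L2_Cauchy_Schwarz x u : csq (L2dot x u) <= L2sq x * L2sq u.
Proof. by apply: L2_almost_minimal => c; rewrite lerDr L2sq_ge0. Qed.

Lemma L2sq_parallelogram x y :
  L2sq (x - y) = 2 * L2sq x + 2 * L2sq y - L2sq (x + y).
Proof.
rewrite /L2sq !(L2dotDl, L2dotDr, L2dotNl, L2dotNr).
by case: (L2dot x x) (L2dot x y) (L2dot y x) (L2dot y y) => [? ?] [? ?] [? ?] [? ?] /=; ring.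
Qed.

Lemma L2sqZ (c : R) x : L2sq (c%:C%C *: x) = c ^+ 2 * L2sq x.
Proof.
rewrite {1}/L2sq L2dotZl L2dotZr L2dotxx /=; ring.
Qed.

(** D need not be closed, so f has no nearest point in D itself. A minimizing sequence in D
    converges to some g by completeness; f - g is orthogonal to D as the limit of almost minimal
    vectors, hence f = g. *)
Lemma L2_dense_of_orthogonal D : D 0 ->
  (forall (c : C) u v, D u -> D v -> D (c *: u + v)) ->
  (forall h, (forall u, D u -> L2dot h u = 0) -> h = 0) ->
  forall f (e : R), 0 < e -> exists2 u, D u & L2norm (f - u) < e.
Proof.
move=> D0 Dlin Dorth f e e0.
have DD u v : D u -> D v -> D (u + v).
  by move=> Du Dv; rewrite -[u]scale1r; exact: Dlin.
have DZ c u : D u -> D (c *: u).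
  by move=> Du; rewrite -[c *: u]addr0; exact: Dlin.
pose X : set R := [set L2sq (f - u) | u in D].
have infX : has_inf X.
  split; first by exists (L2sq (f - 0)), 0.
  by exists 0 => _ [u _ <-]; exact: L2sq_ge0.
pose d := inf X.
have dle u : D u -> d <= L2sq (f - u).
  by move=> Du; apply: ge_inf; [case: infX|exists u].
(* The midpoint of two iterates lies in D, at squared distance at least d from f, so the
   parallelogram law bounds the squared increment by 2 (ep n + ep (n + 1)), which is below 16^-n. *)
pose ep n : R := 16^-1 ^+ n / 4.
have ep0 n : 0 < ep n by rewrite divr_gt0// exprn_gt0// invr_gt0.
have pick n : {u | D u /\ L2sq (f - u) < d + ep n}.
  apply: cid; have [_ [u Du <-] lt] := inf_adherent (ep0 n) infX.
  by exists u.
pose u n := sval (pick n).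
have Du n : D (u n) by have [] := svalP (pick n).
have ud n : L2sq (f - u n) < d + ep n by have [] := svalP (pick n).
have uS n : L2sq (u n.+1 - u n) <= 16^-1 ^+ n.
  have -> : u n.+1 - u n = (f - u n) - (f - u n.+1).
    by rewrite opprB [RHS]addrC addrA subrK.
  rewrite L2sq_parallelogram.
  have -> : (f - u n) + (f - u n.+1) =
      (2%:R : R)%:C%C *: (f - (2^-1)%:C%C *: (u n + u n.+1)).
    rewrite scalerBr scalerA -rmorphM /= divff ?pnatr_eq0// scale1r.
    have -> : ((2%:R : R)%:C%C : C) = 1 + 1 by rewrite -(rmorph1 (real_complex R)) -rmorphD.
    by rewrite scalerDl scale1r opprD addrACA.
  rewrite L2sqZ.
  have := dle _ (DZ (2^-1)%:C%C _ (DD _ _ (Du n) (Du n.+1))).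
  have := ud n; have := ud n.+1; rewrite /ep exprS.
  have : 0 < (16^-1 : R) ^+ n by rewrite exprn_gt0// invr_gt0.
  lra.
have [g gu] := L2_complete uS.
have almost n w : D w -> csq (L2dot (f - u n) w) <= ep n * L2sq w.
  move=> Dw; apply: L2_almost_minimal => c.
  have -> : f - u n - c *: w = f - (u n + c *: w) by rewrite opprD addrA.
  have := dle _ (DD _ _ (Du n) (DZ c _ Dw)); have := ud n; lra.
have small (c : R) : 0 <= c -> forall r, (forall n, r <= c * 4^-1 ^+ n) -> r <= 0.
  move=> c0 r rn; have cv : (c * 4^-1 ^+ n) @[n --> \oo] --> (c * 0 : R).
    apply: cvgM; first exact: cvg_cst.
    by apply: cvg_expr; rewrite ger0_norm ?invr_ge0// invf_lt1// ltr1n.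
  rewrite -(mulr0 c) -(cvg_lim _ cv)//; apply: limr_ge; last exact: nearW.
  by apply/cvg_ex; eexists; exact: cv.
have fg : f - g = 0.
  apply: Dorth => w Dw; apply: csq_eq0.
  (* 34 = 2 * 1 + 2 * 16: the first term for f - u n, where ep n <= 4^-n, the second for u n - g, by
     Cauchy-Schwarz. *)
  apply: (small (34 * L2sq w)); first by rewrite mulr_ge0// L2sq_ge0.
  move=> n; have -> : f - g = (f - u n) + (u n - g) by rewrite addrA subrK.
  rewrite L2dotDl; apply: (le_trans (csqD_le _ _)).
  have := almost n w Dw; have := L2_Cauchy_Schwarz (u n - g) w.
  have -> : L2sq (u n - g) = L2sq (g - u n).
    by rewrite -opprB -scaleN1r /L2sq L2dotZl L2dotZr L2dotxx /=; ring.
  have h1 := ler_wpM2r (L2sq_ge0 w) (gu n).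
  have h2 : ep n * L2sq w <= 4^-1 ^+ n * L2sq w.
    apply: ler_wpM2r; first exact: L2sq_ge0.
    rewrite /ep (@le_trans _ _ (16^-1 ^+ n))//.
      rewrite ler_pdivrMr// ler_peMr ?exprn_ge0 ?invr_ge0// ler1n//.
    by rewrite lerXn2r ?nnegrE ?invr_ge0// lef_pV2 ?posrE// ler_nat.
  lra.
have fgE : f = g by apply/eqP; rewrite -subr_eq0 fg.
have [n nlt] : exists n, 16 * 4^-1 ^+ n < e ^+ 2.
  apply: contrapT => /forallNP h.
  suff : e ^+ 2 <= 0 by rewrite leNgt exprn_gt0.
  by apply: (small 16) => // n; rewrite leNgt; apply/negP; exact: h.
exists (u n) => //; rewrite /L2norm -[X in _ < X](ger0_norm (ltW e0)) -sqrtr_sqr.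
rewrite ltr_sqrt ?exprn_gt0//; apply: le_lt_trans nlt.
by rewrite fgE; exact: gu.
Qed.

End orthogonal_projection.

(** * The maximal operator *)

Section almost_everywhere.
Context {R : realType} (a b : R).
Hypothesis ab : a < b.
Local Notation mu := (@lebesgue_measure R).
Local Notation C := R[i].
Local Notation re := (@complex.Re R).
Local Notation im := (@complex.Im R).
Local Notation J := (`]a, b[%classic : set R).

Lemma abs_continuous_re (F : R -> C) : abs_cont a b F -> abs_continuous a b (re \o F).
Proof.
apply: abs_continuous_abs_cont => s t /=.
case: (F t) (F s) => [x1 y1] [x2 y2] /=.
by rewrite -sqrtr_sqr ler_wsqrtr// lerDl sqr_ge0.
Qed.

Lemma abs_continuous_im (F : R -> C) : abs_cont a b F -> abs_continuous a b (im \o F).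
Proof.
apply: abs_continuous_abs_cont => s t /=.
case: (F t) (F s) => [x1 y1] [x2 y2] /=.
by rewrite -sqrtr_sqr ler_wsqrtr// lerDr sqr_ge0.
Qed.

Lemma ae_itv_exists (P : R -> Prop) (s t : R) : s < t ->
  {ae mu, forall x, P x} -> exists2 x, s < x < t & P x.
Proof.
move=> st [N [mN N0 PN]]; apply: contrapT => /forall2NP h.
have : (mu `]s, t[%classic <= mu N)%E.
  rewrite le_measure ?inE//= => x /=; rewrite in_itv /= => xst; apply: PN => /= Px.
  by have [] := h x.
rewrite N0 lebesgue_measure_itv /= lte_fin st lee_fin subr_le0 leNgt.
by rewrite st.
Qed.

(** Near each point of [a, b], endpoints included, there is an interval of positive measure inside,
    hence a point of agreement. This makes the boundary values of an L_2 class well defined. *)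
Lemma abs_continuous_ae_eq (f g : R -> R) :
  abs_continuous a b f -> abs_continuous a b g ->
  {ae mu, forall x, J x -> f x = g x} -> {in `[a, b], f =1 g}.
Proof.
move=> acf acg fg x; rewrite in_itv /= => /andP[ax xb].
apply/eqP; rewrite -subr_eq0; apply/eqP; apply: contrapT => /eqP fgx.
have e0 : 0 < `|f x - g x| by rewrite normr_gt0.
have [d d0 dP] := abs_continuousB acf acg e0.
have [y /andP[y1 y2] fgy] : exists2 y,
    Num.max a (x - d) < y < Num.min b (x + d) & (J y -> f y = g y).
  apply: (ae_itv_exists _ fg); rewrite lt_min !gt_max ab /=.
  by apply/and3P; split; lra.
move: y1 y2; rewrite gt_max lt_min => /andP[ay xy] /andP[yb yx].
have {}fgy : f y - g y = 0 by rewrite fgy ?subrr//= in_itv /= ay.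
have [xley|/ltW ylex] := leP x y.
  have := dP [:: (x, y)]; rewrite /total_length /total_jump !big_seq1 /= fgy.
  rewrite sub0r normrN ltxx subitvs_cons /= ax xley (ltW yb) /=.
  by move=> /(_ isT); rewrite ltrBlDl yx => /(_ isT).
have := dP [:: (y, x)]; rewrite /total_length /total_jump !big_seq1 /= fgy.
rewrite subr0 ltxx subitvs_cons /= (ltW ay) ylex xb /=.
by move=> /(_ isT); rewrite ltrBlDl -ltrBlDr xy => /(_ isT).
Qed.

Lemma abs_cont_ae_eq (F G : R -> C) : abs_cont a b F -> abs_cont a b G ->
  {ae mu, forall x, J x -> F x = G x} -> {in `[a, b], F =1 G}.
Proof.
move=> acF acG FG x xab; apply/eqP; rewrite eq_complex; apply/andP; split; apply/eqP.
  apply: (abs_continuous_ae_eq (abs_continuous_re acF) (abs_continuous_re acG)) xab.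
  apply: filterS FG; first exact: (ae_filter_ringOfSetsType mu).
  by move=> y h /h /= ->.
apply: (abs_continuous_ae_eq (abs_continuous_im acF) (abs_continuous_im acG)) xab.
apply: filterS FG; first exact: (ae_filter_ringOfSetsType mu).
by move=> y h /h /= ->.
Qed.

Lemma ac_rep_ae (F : R -> C) : abs_cont a b (ac_rep a b F) ->
  {ae mu, forall x, J x -> ac_rep a b F x = F x}.
Proof.
rewrite /ac_rep; case: xgetP => [G _ [_ GF]//|nex acF].
(* The default value of [ac_rep] is F itself; were it absolutely continuous, it would be a
   representative of itself. *)
by exfalso; apply: (nex F); split=> //; apply: aeW.
Qed.

Lemma ac_repP (F G : R -> C) : abs_cont a b G ->
  {ae mu, forall x, J x -> G x = F x} ->
  abs_cont a b (ac_rep a b F) /\ {in `[a, b], ac_rep a b F =1 G}.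
Proof.
move=> acG GF.
have [acr rF] : abs_cont a b (ac_rep a b F) /\
    {ae mu, forall x, J x -> ac_rep a b F x = F x}.
  by rewrite /ac_rep; case: xgetP => [G' _ []//|/(_ G)[]].
split=> //; apply: abs_cont_ae_eq => //.
apply: (@filterS2 _ _ (ae_filter_ringOfSetsType mu) _ _ _ _ rF GF).
by move=> x h1 h2 Jx; rewrite h1// h2.
Qed.

Lemma is_derive1_derive1 (f : R -> R) (x l : R) : is_derive x 1 f l -> derive1 f x = l.
Proof. by move=> [_ <-]; rewrite derive1E. Qed.

Lemma primitive_derive1 (h f : R -> R) : primitive a b h f ->
  {ae mu, forall x, J x -> derive1 f x = h x}.
Proof.
move=> /primitive_is_derive.
apply: filterS; first exact: (ae_filter_ringOfSetsType mu).
by move=> x h' /h'; exact: is_derive1_derive1.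
Qed.

Lemma L2_integrable (u : L2 a b) : mu.-integrable J (EFin \o (re \o u)) /\
  mu.-integrable J (EFin \o (im \o u)).
Proof.
have [mr mi ir ii] := (square_integrableE a b _).1 (L2_square_integrable u).
have i1 : mu.-integrable J (EFin \o (fun=> 1 ^+ 2 : R)).
  apply/integrableP; split; first exact/measurable_EFinP.
  rewrite /= integral_cst//= lebesgue_measure_itv /= lte_fin ab.
  by rewrite -EFinD -EFinM ltry.
have m1 : measurable_fun J (fun=> 1 : R) by [].
split.
  have := integrable_mul_square mr m1 ir i1.
  by congr (_.-integrable _ (_ \o _)); apply/funext => t; rewrite mulr1.
have := integrable_mul_square mi m1 ii i1.
by congr (_.-integrable _ (_ \o _)); apply/funext => t; rewrite mulr1.
Qed.

End almost_everywhere.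

(** * The quasi-differential equation as a first-order system *)

Section quasi_derivative_system.
Context {R : realType} (a b : R).
Hypothesis ab : a < b.
Local Notation mu := (@lebesgue_measure R).
Local Notation C := R[i].
Local Notation re := (@complex.Re R).
Local Notation im := (@complex.Im R).
Local Notation J := (`]a, b[%classic : set R).
Local Notation H := (L2 a b).
(** [be], [al], [ga] are integrable functions equal almost everywhere to 1 / p, Q / p, Q^2 / p, as
    provided by [in_L1]. *)
Variables p Q al be ga : R -> R.
Hypothesis p0 : {ae mu, forall x, J x -> p x != 0}.
Hypothesis ibe : mu.-integrable J (EFin \o be).
Hypothesis ial : mu.-integrable J (EFin \o al).
Hypothesis iga : mu.-integrable J (EFin \o ga).
Hypothesis beE : {ae mu, forall x, J x -> 1 / p x = be x}.
Hypothesis alE : {ae mu, forall x, J x -> Q x / p x = al x}.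
Hypothesis gaE : {ae mu, forall x, J x -> Q x ^+ 2 / p x = ga x}.

(* With z for the quasi-derivative, l[y] = f is the first-order system
   y' = z / p + (Q / p) y, z' = - (Q / p) z - (Q^2 / p) y - f. *)
Definition system (f y z : R -> R) :=
  primitive a b (fun x => be x * z x + al x * y x) y /\
  primitive a b (fun x => - al x * z x - ga x * y x - f x) z.

Definition csystem (f y z : R -> C) :=
  system (re \o f) (re \o y) (re \o z) /\ system (im \o f) (im \o y) (im \o z).

Lemma system_integrand1 (y z : R -> R) :
  abs_continuous a b y -> abs_continuous a b z ->
  mu.-integrable J (EFin \o (fun x => be x * z x + al x * y x)).
Proof.
move=> acy acz; have := integrable_lin 1 1 (integrable_mul_bounded ab ibe acz)
  (integrable_mul_bounded ab ial acy).
by congr (_.-integrable _ (_ \o _)); apply/funext => t; rewrite !mul1r.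
Qed.

Lemma system_integrand2 (f y z : R -> R) : mu.-integrable J (EFin \o f) ->
  abs_continuous a b y -> abs_continuous a b z ->
  mu.-integrable J (EFin \o (fun x => - al x * z x - ga x * y x - f x)).
Proof.
move=> if_ acy acz; have := integrable_lin 1 (-1)
  (integrable_lin (-1) (-1) (integrable_mul_bounded ab ial acz)
    (integrable_mul_bounded ab iga acy)) if_.
by congr (_.-integrable _ (_ \o _)); apply/funext => t; ring.
Qed.

Lemma quasi_derivative_system (f y z : R -> R) : mu.-integrable J (EFin \o f) ->
  abs_continuous a b y -> abs_continuous a b z ->
  {ae mu, forall x, J x -> z x = p x * derive1 y x - Q x * y x} ->
  {ae mu, forall x, J x ->
    f x = - (derive1 z x + Q x / p x * z x + Q x ^+ 2 / p x * y x)} ->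
  system f y z.
Proof.
move=> if_ acy acz zE fE.
have [h ph] := abs_continuous_primitive ab acy.
have [k pk] := abs_continuous_primitive ab acz.
split.
  apply: (primitive_congr ph); first exact: system_integrand1.
  have pz := @filterS2 _ _ (ae_filter_ringOfSetsType mu) _ _ _
    (fun x h1 h2 Jx => conj (h1 Jx) (h2 Jx)) zE (primitive_derive1 ph).
  have pp := @filterS3 _ _ (ae_filter_ringOfSetsType mu) _ _ _ _
    (fun x h1 h2 h3 Jx => conj (h1 Jx) (conj (h2 Jx) (h3 Jx))) p0 beE alE.
  apply: (@filterS2 _ _ (ae_filter_ringOfSetsType mu) _ _ _ _ pz pp).
  move=> x H1 H2 Jx; have [Ez Eh] := H1 Jx; have [px [<- <-]] := H2 Jx.
  by rewrite Ez Eh; field.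
apply: (primitive_congr pk); first exact: system_integrand2.
have pz := @filterS2 _ _ (ae_filter_ringOfSetsType mu) _ _ _
  (fun x h1 h2 Jx => conj (h1 Jx) (h2 Jx)) fE (primitive_derive1 pk).
have pp := @filterS2 _ _ (ae_filter_ringOfSetsType mu) _ _ _
  (fun x h2 h3 Jx => conj (h2 Jx) (h3 Jx)) alE gaE.
apply: (@filterS2 _ _ (ae_filter_ringOfSetsType mu) _ _ _ _ pz pp).
move=> x H1 H2 Jx; have [Ef Ek] := H1 Jx; have [<- <-] := H2 Jx.
by rewrite Ef Ek; ring.
Qed.

Lemma system_quasi_derivative (f y z : R -> R) : system f y z ->
  {ae mu, forall x, J x -> z x = p x * derive1 y x - Q x * y x} /\
  {ae mu, forall x, J x ->
    f x = - (derive1 z x + Q x / p x * z x + Q x ^+ 2 / p x * y x)}.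
Proof.
move=> [py pz]; split.
  have pp := @filterS3 _ _ (ae_filter_ringOfSetsType mu) _ _ _ _
    (fun x h1 h2 h3 Jx => conj (h1 Jx) (conj (h2 Jx) (h3 Jx))) p0 beE alE.
  apply: (@filterS2 _ _ (ae_filter_ringOfSetsType mu) _ _ _ _
    (primitive_derive1 py) pp).
  move=> x H1 H2 Jx; have -> := H1 Jx; have [px [<- <-]] := H2 Jx.
  by field.
apply: (@filterS3 _ _ (ae_filter_ringOfSetsType mu) _ _ _ _ _
  (primitive_derive1 pz) alE gaE).
move=> x H1 H2 H3 Jx; have -> := H1 Jx; have -> := H2 Jx; have -> := H3 Jx.
by ring.
Qed.

Lemma csystem_abs_cont (f y z : R -> C) : csystem f y z ->
  abs_cont a b y /\ abs_cont a b z.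
Proof.
move=> [[y1 z1] [y2 z2]].
by split; apply: abs_continuous_complex; apply: primitive_abs_continuous; eauto.
Qed.

Lemma Lmax_csystem (u : H * H) : Lmax p Q u ->
  csystem u.2 (qD0 u.1) (qD1 p Q u.1) /\
  {ae mu, forall x, J x -> u.1 x = qD0 u.1 x}.
Proof.
move=> [ac0 ac1 fE]; have y_ae := ac_rep_ae ac0; have z_ae := ac_rep_ae ac1.
have [if1 if2] := L2_integrable ab u.2.
split; last first.
  apply: filterS y_ae; first exact: (ae_filter_ringOfSetsType mu).
  by move=> x h /h.
split; apply: quasi_derivative_system => //;
  try exact: abs_continuous_re; try exact: abs_continuous_im.
- apply: filterS z_ae; first exact: (ae_filter_ringOfSetsType mu).
  move=> x h /h /= hz; rewrite /qD1 /= hz /cderive; case: (qD0 u.1 x) => y1 y2 /=.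
  by rewrite !mul0r !subr0.
- apply: filterS fE; first exact: (ae_filter_ringOfSetsType mu).
  move=> x h /h /= ->; rewrite /qD2 /cderive /=.
  by case: (qD0 u.1 x) (qD1 p Q u.1 x) => [y1 y2] [z1 z2] /=; ring.
- apply: filterS z_ae; first exact: (ae_filter_ringOfSetsType mu).
  move=> x h /h /= hz; rewrite /qD1 /= hz /cderive; case: (qD0 u.1 x) => y1 y2 /=.
  by ring.
- apply: filterS fE; first exact: (ae_filter_ringOfSetsType mu).
  move=> x h /h /= ->; rewrite /qD2 /cderive /=.
  by case: (qD0 u.1 x) (qD1 p Q u.1 x) => [y1 y2] [z1 z2] /=; ring.
Qed.

Lemma eq_in_itv_derive1 (f g : R -> R) x : J x -> {in `[a, b], f =1 g} ->
  derive1 f x = derive1 g x.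
Proof.
move=> Jx fg; rewrite !derive1E; apply: near_eq_derive.
have : nbhs x J by apply: open_nbhs_nbhs; split => //; exact: itv_open.
apply: filterS => y; rewrite /= in_itv /= => /andP[ay yb]; apply: fg.
by rewrite in_itv /= !ltW.
Qed.

Lemma J_in_itv x : J x -> x \in `[a, b].
Proof. by rewrite /= !in_itv /= => /andP[/ltW -> /ltW ->]. Qed.

(** The chosen representatives [qD0 u] and [qD1 p Q u] agree with y and z on all of [a, b] by
    uniqueness, so their derivatives agree at every point of the open interval and the system can be
    read off. *)
Lemma csystem_Lmax (u f : H) (y z : R -> C) : csystem f y z ->
  {ae mu, forall x, J x -> u x = y x} ->
  [/\ Lmax p Q (u, f), {in `[a, b], qD0 u =1 y} & {in `[a, b], qD1 p Q u =1 z}].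
Proof.
move=> sys uy; have [acy acz] := csystem_abs_cont sys.
have [S1 S2] := sys.
have [z1 f1] := system_quasi_derivative S1.
have [z2 f2] := system_quasi_derivative S2.
have [ac0 E0] : abs_cont a b (qD0 u) /\ {in `[a, b], qD0 u =1 y}.
  apply: ac_repP => //.
  apply: filterS uy; first exact: (ae_filter_ringOfSetsType mu).
  by move=> x h /h ->.
have [ac1 E1] : abs_cont a b (qD1 p Q u) /\ {in `[a, b], qD1 p Q u =1 z}.
  apply: ac_repP => //.
  apply: (@filterS2 _ _ (ae_filter_ringOfSetsType mu) _ _ _ _ z1 z2).
  move=> x h1 h2 Jx; rewrite E0 ?J_in_itv// /cderive.
  have -> : derive1 (re \o qD0 u) x = derive1 (re \o y) x.
    by apply: eq_in_itv_derive1 => // t tab; rewrite /= E0.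
  have -> : derive1 (im \o qD0 u) x = derive1 (im \o y) x.
    by apply: eq_in_itv_derive1 => // t tab; rewrite /= E0.
  move: (h1 Jx) (h2 Jx) => /=; case: (y x) (z x) => [y1 y2] [w1 w2] /= -> ->.
  by apply/eqP; rewrite eq_complex /=; apply/andP; split; apply/eqP; ring.
split=> //; split=> //=.
apply: (@filterS2 _ _ (ae_filter_ringOfSetsType mu) _ _ _ _ f1 f2).
move=> x h1 h2 Jx; rewrite /qD2 E0 ?J_in_itv// E1 ?J_in_itv// /cderive.
have -> : derive1 (re \o qD1 p Q u) x = derive1 (re \o z) x.
  by apply: eq_in_itv_derive1 => // t tab; rewrite /= E1.
have -> : derive1 (im \o qD1 p Q u) x = derive1 (im \o z) x.
  by apply: eq_in_itv_derive1 => // t tab; rewrite /= E1.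
move: (h1 Jx) (h2 Jx) => /=.
case: (f x) (y x) (z x) => [g1 g2] [y1 y2] [w1 w2] /= -> ->.
by apply/eqP; rewrite eq_complex /=; apply/andP; split; apply/eqP; ring.
Qed.

Lemma Lmax_functional (u f g : H) : Lmax p Q (u, f) -> Lmax p Q (u, g) -> f = g.
Proof.
move=> [_ _ fE] [_ _ gE]; apply: L2_eq_ae.
apply: (@filterS2 _ _ (ae_filter_ringOfSetsType mu) _ _ _ _ fE gE).
by move=> x h1 h2 Jx; rewrite h1// h2.
Qed.

Lemma system_lin (c d : R) (f y z g v w : R -> R) : system f y z -> system g v w ->
  system (fun x => c * f x + d * g x) (fun x => c * y x + d * v x)
    (fun x => c * z x + d * w x).
Proof.
move=> [py pz] [pv pw]; split.
  have := primitive_lin c d py pv; congr primitive.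
  by apply/funext => x; ring.
have := primitive_lin c d pz pw; congr primitive.
by apply/funext => x; ring.
Qed.

(** A complex scalar mixes real and imaginary parts by real combinations, which preserve the system
    because its coefficients are real. *)
Lemma csystem_lin (c : C) (f y z g v w : R -> C) :
  csystem f y z -> csystem g v w ->
  csystem (fun x => c * f x + g x) (fun x => c * y x + v x)
    (fun x => c * z x + w x).
Proof.
move=> [S1 S2] [T1 T2]; case: c => c1 c2; split.
  have := system_lin 1 1 (system_lin c1 (- c2) S1 S2) T1; congr system;
  apply/funext => x /=; rewrite !mul1r mulNr;
  by case: (f x) (g x) (y x) (v x) (z x) (w x) =>
    [? ?] [? ?] [? ?] [? ?] [? ?] [? ?].
have := system_lin 1 1 (system_lin c1 c2 S2 S1) T2; congr system;
apply/funext => x /=; rewrite !mul1r;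
by case: (f x) (g x) (y x) (v x) (z x) (w x) =>
  [? ?] [? ?] [? ?] [? ?] [? ?] [? ?].
Qed.

Lemma system_congr (f g y z : R -> R) : system f y z ->
  mu.-integrable J (EFin \o g) -> {ae mu, forall x, J x -> f x = g x} ->
  system g y z.
Proof.
move=> [py pz] ig fg; split=> //; apply: (primitive_congr pz).
  by apply: system_integrand2 => //;
    [exact: primitive_abs_continuous py|exact: primitive_abs_continuous pz].
apply: filterS fg; first exact: (ae_filter_ringOfSetsType mu).
by move=> x h /h ->.
Qed.

Lemma csystem_congr (f : R -> C) (g : H) (y z : R -> C) : csystem f y z ->
  {ae mu, forall x, J x -> f x = g x} -> csystem g y z.
Proof.
move=> [S1 S2] fg; have [i1 i2] := L2_integrable ab g.
split; [apply: (system_congr S1) => //|apply: (system_congr S2) => //];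
  (apply: filterS fg; first exact: (ae_filter_ringOfSetsType mu));
  by move=> x h /h /= ->.
Qed.

Lemma Lmax_lin (c : C) (u v : H * H) : Lmax p Q u -> Lmax p Q v ->
  [/\ Lmax p Q (c *: u + v),
    {in `[a, b], forall x, qD0 (c *: u + v).1 x = c * qD0 u.1 x + qD0 v.1 x} &
    {in `[a, b], forall x,
      qD1 p Q (c *: u + v).1 x = c * qD1 p Q u.1 x + qD1 p Q v.1 x}].
Proof.
move=> /Lmax_csystem[S1 E1] /Lmax_csystem[S2 E2].
have S := csystem_lin c S1 S2.
have [] := @csystem_Lmax (c *: u.1 + v.1) (c *: u.2 + v.2) _ _ (csystem_congr S _) _.
- apply: filterS (L2_lin_ae c u.2 v.2); first exact: (ae_filter_ringOfSetsType mu).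
  by move=> x h /h ->.
- apply: (@filterS3 _ _ (ae_filter_ringOfSetsType mu) _ _ _ _ _
    (L2_lin_ae c u.1 v.1) E1 E2).
  by move=> x h h1 h2 Jx; rewrite h// h1// h2.
by move=> ? ? ?; split.
Qed.

(** In the derivative of y w - z v all terms with coefficients cancel, leaving f v - y g; no
    integration by parts with p is involved. *)
Lemma system_green (f y z g v w : R -> R) : system f y z -> system g v w ->
  mu.-integrable J (EFin \o (fun x => f x * v x - y x * g x)) /\
  \int[mu]_(x in J) (f x * v x - y x * g x) =
  (y b * w b - z b * v b) - (y a * w a - z a * v a).
Proof.
move=> [py pz] [pv pw].
have := primitive_lin 1 (-1) (primitive_mul ab py pw) (primitive_mul ab pz pv).
set h := (fun _ => _); set F := (fun _ => _).
have -> : h = (fun x => f x * v x - y x * g x) by apply/funext => x; rewrite /h; ring.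
move=> [ih Fx]; split=> //.
have : b \in `[a, b] by rewrite in_itv /= lexx ltW.
by move=> /Fx; rewrite /F; lra.
Qed.

(** Sesquilinear expansion into the four real identities pairing real and imaginary parts. *)
Lemma csystem_green (f y z g v w : R -> C) : csystem f y z -> csystem g v w ->
  cintegrable a b (fun x => f x * (v x)^*%C - y x * (g x)^*%C) /\
  cintegral a b (fun x => f x * (v x)^*%C - y x * (g x)^*%C) =
  (y b * (w b)^*%C - z b * (v b)^*%C) - (y a * (w a)^*%C - z a * (v a)^*%C).
Proof.
move=> [S1 S2] [T1 T2].
have [i11 e11] := system_green S1 T1; have [i22 e22] := system_green S2 T2.
have [i12 e12] := system_green S1 T2; have [i21 e21] := system_green S2 T1.
have Er : re \o (fun x => f x * (v x)^*%C - y x * (g x)^*%C) = (fun x =>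
    1 * (re (f x) * re (v x) - re (y x) * re (g x)) +
    1 * (im (f x) * im (v x) - im (y x) * im (g x))).
  apply/funext => x /=; case: (f x) (v x) (y x) (g x) => [? ?] [? ?] [? ?] [? ?] /=.
  by ring.
have Ei : im \o (fun x => f x * (v x)^*%C - y x * (g x)^*%C) = (fun x =>
    1 * (im (f x) * re (v x) - im (y x) * re (g x)) +
    (-1) * (re (f x) * im (v x) - re (y x) * im (g x))).
  apply/funext => x /=; case: (f x) (v x) (y x) (g x) => [? ?] [? ?] [? ?] [? ?] /=.
  by ring.
split; first by split; rewrite ?Er ?Ei; exact: integrable_lin.
have -> : cintegral a b (fun x => f x * (v x)^*%C - y x * (g x)^*%C) =
    Complex (\int[mu]_(x in J) (re \o (fun x => f x * (v x)^*%C - y x * (g x)^*%C)) x)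
      (\int[mu]_(x in J) (im \o (fun x => f x * (v x)^*%C - y x * (g x)^*%C)) x) by [].
rewrite Er Ei (Rintegral_lin 1 1 i11 i22) (Rintegral_lin 1 (-1) i21 i12).
rewrite [X in Complex (1 * X + _)]e11 [X in Complex (_ + 1 * X)]e22.
rewrite [X in Complex _ (1 * X + _)]e21 [X in Complex _ (_ + -1 * X)]e12 /=.
case: (y b) (w b) (z b) (v b) => [? ?] [? ?] [? ?] [? ?].
case: (y a) (w a) (z a) (v a) => [? ?] [? ?] [? ?] [? ?].
by apply/eqP; rewrite eq_complex /=; apply/andP; split; apply/eqP; ring.
Qed.

Lemma Lmax_green (u v : H * H) : Lmax p Q u -> Lmax p Q v ->
  let y := qD0 u.1 in let z := qD1 p Q u.1 in
  let y' := qD0 v.1 in let z' := qD1 p Q v.1 in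
  L2dot u.2 v.1 - L2dot u.1 v.2 =
  (y b * (z' b)^*%C - z b * (y' b)^*%C) - (y a * (z' a)^*%C - z a * (y' a)^*%C).
Proof.
move=> /Lmax_csystem[S1 E1] /Lmax_csystem[S2 E2] y z y' z'.
have [iG <-] := csystem_green S1 S2.
have I1 := L2dot_cintegrable u.1 v.2; have I2 := L2dot_cintegrable u.2 v.1.
have -> : L2dot u.2 v.1 - L2dot u.1 v.2 = -1 * L2dot u.1 v.2 + L2dot u.2 v.1.
  by rewrite mulN1r addrC.
rewrite -[LHS](cintegral_lin (-1) I1 I2).
have [m1 m2] := cintegrable_measurable (cintegrable_lin (-1) I1 I2).
have [m3 m4] := cintegrable_measurable iG.
apply: ae_eq_cintegral => //.
apply: (@filterS2 _ _ (ae_filter_ringOfSetsType mu) _ _ _ _ E1 E2).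
by move=> x h1 h2 Jx; rewrite h1// h2// mulN1r addrC.
Qed.

Lemma system_exists (f : R -> R) (c d : R) : mu.-integrable J (EFin \o f) ->
  exists y z, [/\ system f y z, y a = c & z a = d].
Proof.
move=> if_.
(* Index [true] stands for y and [false] for z. *)
pose A (i j : bool) : R -> R := if i then (if j then al else be)
  else (if j then (fun x => - ga x) else (fun x => - al x)).
pose F (i : bool) : R -> R := if i then (fun=> 0) else (fun x => - f x).
have iN h : mu.-integrable J (EFin \o h) ->
    mu.-integrable J (EFin \o (fun x => - h x)).
  move=> ih; have := integrable_lin (-1) 0 ih ih.
  by congr (_.-integrable _ (_ \o _)); apply/funext => t; ring.
have iA i j : mu.-integrable J (EFin \o A i j).
  by case: i j => [] [] //=; exact: iN.
have iF i : mu.-integrable J (EFin \o F i).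
  case: i => /=; last exact: iN.
  have := integrable_lin 0 0 if_ if_.
  by congr (_.-integrable _ (_ \o _)); apply/funext => t; ring.
have [Y YP] := linear_ode_solution ab (fun i => if i then c else d) iA iF.
have [[Yt pt] [Yf pf]] := (YP true, YP false).
exists (Y true), (Y false); split=> //; split.
  by move: pt; congr primitive; apply/funext => x; rewrite big_bool /=; ring.
by move: pf; congr primitive; apply/funext => x; rewrite big_bool /=; ring.
Qed.

Lemma abs_cont_square_integrable (F : R -> C) : abs_cont a b F ->
  F \in square_integrable a b.
Proof.
move=> acF; have i1 : mu.-integrable J (EFin \o (fun=> 1 : R)).
  apply/integrableP; split; first exact/measurable_EFinP.
  rewrite /= integral_cst//= lebesgue_measure_itv /= lte_fin ab.
  by rewrite -EFinD -EFinM ltry.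
have acr := abs_continuous_re acF; have aci := abs_continuous_im acF.
have sq h : abs_continuous a b h -> mu.-integrable J (EFin \o (fun x => h x ^+ 2)).
  move=> ach; have ih := integrable_mul_bounded ab i1 ach.
  have := integrable_mul_bounded ab ih ach.
  by congr (_.-integrable _ (_ \o _)); apply/funext => t; rewrite mul1r.
apply/square_integrableE; split; try exact: abs_continuous_measurable; exact: sq.
Qed.

Lemma Lmax_exists (f : H) (c d : C) : exists u : H,
  [/\ Lmax p Q (u, f), qD0 u a = c & qD1 p Q u a = d].
Proof.
have [i1 i2] := L2_integrable ab f; case: c d => [c1 c2] [d1 d2].
have [y1 [z1 [S1 y1a z1a]]] := system_exists c1 d1 i1.
have [y2 [z2 [S2 y2a z2a]]] := system_exists c2 d2 i2.
pose y x := Complex (y1 x) (y2 x); pose z x := Complex (z1 x) (z2 x).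
have S : csystem f y z by split.
have [acy _] := csystem_abs_cont S.
have hy := abs_cont_square_integrable acy.
have [Lu yE zE] := csystem_Lmax S (L2_of_ae hy).
have aab : a \in `[a, b] by rewrite in_itv /= lexx ltW.
exists (L2_of hy); split=> //.
  by rewrite yE// /y y1a y2a.
by rewrite zE// /z z1a z2a.
Qed.

Lemma Lmax0 : Lmax p Q (0 : H * H).
Proof.
(* Writing the zero pair as a difference of equal elements avoids any computation with the
   representative of the class 0. *)
have [u [Lu _ _]] := Lmax_exists 0 0 0.
have [+ _ _] := Lmax_lin (-1) Lu Lu.
by rewrite scaleN1r addNr.
Qed.

End quasi_derivative_system.

(** * Boundary values and self-adjoint extensions *)

Section unitary_relations.
Context {R : realType}.
Local Notation C := R[i].
Implicit Types (x y p q m g : 'cV[C]_2) (K : 'M[C]_2).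

Definition cdot x y : C := x 0 0 * (y 0 0)^*%C + x 1 0 * (y 1 0)^*%C.

Lemma cdot0l x : cdot 0 x = 0.
Proof. by rewrite /cdot !mxE !mul0r addr0. Qed.

Lemma cdot0r x : cdot x 0 = 0.
Proof.
have c0 : (0 : C)^*%C = 0 by rewrite /= oppr0.
by rewrite /cdot !mxE c0 !mulr0 addr0.
Qed.

Lemma cV2P x y : x 0 0 = y 0 0 -> x 1 0 = y 1 0 -> x = y.
Proof.
move=> h0 h1; apply/matrixP => i j; rewrite ord1.
case: i => [[|[|//]] Hi]; [move: h0|move: h1]; congr (x _ 0 = y _ 0);
exact: val_inj.
Qed.

Lemma mulmx2E K x i : (K *m x) i 0 = K i 0 * x 0 0 + K i 1 * x 1 0.
Proof.
rewrite mxE big_ord_recl big_ord_recl big_ord0 addr0.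
by congr (_ * x _ 0 + K i _ * x _ 0); exact: val_inj.
Qed.

Definition adjointmx K : 'M[C]_2 := map_mx Num.conj K^T.

Lemma cdot_adjointmx K x y : cdot (K *m x) y = cdot x (adjointmx K *m y).
Proof.
rewrite /cdot !mulmx2E /adjointmx !mxE !conjcD !conjcM.
rewrite -![Num.conj _]/(_^*%C) !conjc_conj; ring.
Qed.

Lemma cdot_eq x y : (forall p, cdot p x = cdot p y) -> x = y.
Proof.
move=> h; have e i p : cdot (delta_mx i 0) p = (p i 0)^*%C.
  rewrite /cdot !mxE /=; case: i => [[|[|//]] Hi] /=.
    by rewrite mul1r mul0r addr0; congr ((p _ 0)^*%C); exact: val_inj.
  by rewrite mul1r mul0r add0r; congr ((p _ 0)^*%C); exact: val_inj.
have cI i : x i 0 = y i 0.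
  by have := h (delta_mx i 0); rewrite !e => /(congr1 (@conjc R)); rewrite !conjc_conj.
exact: cV2P.
Qed.

Lemma cdot_xx_eq0 x : cdot x x = 0 -> x = 0.
Proof.
rewrite /cdot; case E0: (x 0 0) => [u v]; case E1: (x 1 0) => [s t] /=.
move=> [h _]; have {}h : u ^+ 2 + v ^+ 2 + (s ^+ 2 + t ^+ 2) = 0.
  by rewrite -[RHS]h; ring.
move/eqP: h; rewrite paddr_eq0 ?addr_ge0 ?sqr_ge0// => /andP[].
rewrite !paddr_eq0 ?sqr_ge0// !sqrf_eq0 => /andP[/eqP u0 /eqP v0] /andP[/eqP s0 /eqP t0].
by apply: cV2P; rewrite mxE ?E0 ?E1 ?u0 ?v0 ?s0 ?t0.
Qed.

Lemma unitary_cdot K x y : K \is unitarymx -> cdot (K *m x) (K *m y) = cdot x y.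
Proof.
move=> /unitarymxP KK; rewrite cdot_adjointmx mulmxA.
have -> : adjointmx K *m K = 1%:M by apply: mulmx1C; exact: KK.
by rewrite mul1mx.
Qed.

Lemma cdot_unitary K : (forall x y, cdot (K *m x) (K *m y) = cdot x y) ->
  K \is unitarymx.
Proof.
move=> h; apply/unitarymxP; apply: mulmx1C; rewrite -[X in X *m _]/(adjointmx K).
have KK y : adjointmx K *m K *m y = y.
  by apply: cdot_eq => p; rewrite -mulmxA -cdot_adjointmx h.
by apply/matrixP => i j; have := KK (delta_mx j 0);
  rewrite -colE => /matrixP/(_ i 0); rewrite !mxE eqxx andbT.
Qed.

(* If P were a line through x, then (- conj x1, conj x0) would be orthogonal to P. *)
Lemma orthogonal_trivial_full (P : set 'cV[C]_2) :
  P 0 -> (forall (c : C) x y, P x -> P y -> P (c *: x + y)) ->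
  (forall q, (forall x, P x -> cdot x q = 0) -> q = 0) -> forall x, P x.
Proof.
move=> P0 Plin Porth.
pose det x y := x 0 0 * y 1 0 - x 1 0 * y 0 0.
have [x [y [Px Py /eqP dxy]]] : exists x y, [/\ P x, P y & det x y <> 0].
  apply: contrapT => h.
  have {}h x y : P x -> P y -> det x y = 0.
    by move=> Px Py; apply: contrapT => d; apply: h; exists x, y.
  have P00 x : P x -> x = 0.
    move=> Px; pose q : 'cV[C]_2 := \col_(i < 2) if i == 0 then - (x 1 0)^*%C else (x 0 0)^*%C.
    have : q = 0.
      apply: Porth => y Py; rewrite /cdot !mxE /=.
      have -> : (- (x 1 0)^*%C)^*%C = - x 1 0 :> C.
        by case: (x 1 0) => ? ? /=; rewrite opprK.
      by rewrite conjc_conj -[RHS](h x y Px Py) /det; ring.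
    move=> /matrixP q0; have := q0 0 0; have := q0 1 0; rewrite !mxE /=.
    move=> h0 h1; apply: cV2P; rewrite mxE; apply/eqP; rewrite -conjc_eq0; apply/eqP => //.
    by apply/eqP; rewrite -oppr_eq0; apply/eqP.
  (* Here P is {0}, so every vector is orthogonal to it and would have to vanish. *)
  have : delta_mx 0 0 = 0 :> 'cV[C]_2.
    by apply: Porth => x /P00 ->; rewrite /cdot !mxE !mul0r addr0.
  by move=> /matrixP/(_ 0 0); rewrite !mxE /= => /eqP; rewrite oner_eq0.
(* Cramer's rule in the basis x, y. *)
move=> z; pose c := det z y / det x y; pose d := det x z / det x y.
have -> : z = c *: x + (d *: y + 0).
  by rewrite addr0; apply: cV2P; rewrite !mxE /c /d /det; field; exact: dxy.
exact: (Plin c _ _ Px (Plin d _ _ Py P0)).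
Qed.

(* S is the graph of an isometry, since (0, m) in S gives <m, m> = 0, with full
   domain, since q orthogonal to the domain gives (q, 0) in S, so <q, q> = 0. *)
Lemma selforthogonal_graph_unitary (S : set ('cV[C]_2 * 'cV[C]_2)) : S 0 ->
  (forall (c : C) (x y : 'cV[C]_2 * 'cV[C]_2), S x -> S y -> S (c *: x + y)) ->
  (forall x : 'cV[C]_2 * 'cV[C]_2, S x <->
    (forall y : 'cV[C]_2 * 'cV[C]_2, S y -> cdot y.1 x.1 = cdot y.2 x.2)) ->
  exists2 K, K \is unitarymx & forall x : 'cV[C]_2 * 'cV[C]_2, S x <-> x.2 = K *m x.1.
Proof.
move=> S0 Slin Sorth.
have full p : exists m, S (p, m).
  apply: (@orthogonal_trivial_full [set p | exists m, S (p, m)]).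
  - by exists 0.
  - by move=> c x y [m Sm] [n Sn]; exists (c *: m + n); exact: (Slin c _ _ Sm Sn).
  move=> q qP; have Sq : S (q, 0).
    apply/Sorth => -[y1 y2] Sy /=; rewrite qP; last by exists y2.
    by rewrite cdot0r.
  have /Sorth/(_ _ Sq) /= := Sq.
  by rewrite cdot0l; exact: cdot_xx_eq0.
have func p m n : S (p, m) -> S (p, n) -> m = n.
  move=> Sm Sn; have := Slin (-1) _ _ Sm Sn.
  rewrite scaleN1r /GRing.add /= => Sd.
  have S0d : S (0, - m + n) by move: Sd; rewrite /add_pair /= addNr.
  have /Sorth/(_ _ S0d) /= := S0d.
  rewrite cdot0l => /esym/cdot_xx_eq0 /eqP.
  by rewrite addrC subr_eq0 => /eqP.
have [m0 S0m] := full (delta_mx 0 0); have [m1 S1m] := full (delta_mx 1 0).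
pose K : 'M[C]_2 := \matrix_(i, j) if j == 0 then m0 i 0 else m1 i 0.
have SK p : S (p, K *m p).
  have := Slin (p 0 0) _ _ S0m (Slin (p 1 0) _ _ S1m S0).
  congr S; congr (_, _); apply: cV2P; rewrite ?mulmx2E !mxE /=; ring.
exists K.
  by apply: cdot_unitary => x y; have /Sorth/(_ _ (SK x)) /= -> := SK y.
move=> [p m] /=; split=> [Sm|->]; last exact: SK.
exact: func Sm (SK p).
Qed.

End unitary_relations.

(** * Extension theory of an abstract boundary triple *)

Section boundary_triple.
Context {R : realType} (a b : R).
Local Notation C := R[i].
Local Notation H := (L2 a b).
(* In the application M is the graph of the maximal operator, and ya, yb, za, zb
   are y(a), y(b), D^[1] y(a), D^[1] y(b). *)
Variables (M : set (H * H)) (ya yb za zb : H -> C).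
Implicit Types u v w : H * H.
Hypothesis Mfun : forall f g h : H, M (f, g) -> M (f, h) -> g = h.
Hypothesis M0 : M (0 : H * H).
Hypothesis Mlin : forall (c : C) u v, M u -> M v -> M (c *: u + v).
Hypothesis yalin : forall (c : C) u v, M u -> M v ->
  ya (c *: u + v).1 = c * ya u.1 + ya v.1.
Hypothesis yblin : forall (c : C) u v, M u -> M v ->
  yb (c *: u + v).1 = c * yb u.1 + yb v.1.
Hypothesis zalin : forall (c : C) u v, M u -> M v ->
  za (c *: u + v).1 = c * za u.1 + za v.1.
Hypothesis zblin : forall (c : C) u v, M u -> M v ->
  zb (c *: u + v).1 = c * zb u.1 + zb v.1.
Hypothesis Mgreen : forall u v, M u -> M v ->
  L2dot u.2 v.1 - L2dot u.1 v.2 =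
  (yb u.1 * (zb v.1)^*%C - zb u.1 * (yb v.1)^*%C) -
  (ya u.1 * (za v.1)^*%C - za u.1 * (ya v.1)^*%C).
Hypothesis Mex : forall (f : H) (c d : C),
  exists u : H, [/\ M (u, f), ya u = c & za u = d].

Definition trace1 (f : H) : 'cV[C]_2 := \col_(i < 2) (if i == 0 then za f else - zb f).

Definition trace2 (f : H) : 'cV[C]_2 := \col_(i < 2) (if i == 0 then ya f else yb f).

Local Notation G1 u := (trace1 u.1).
Local Notation G2 u := (trace2 u.1).

Lemma trace1_0 f : trace1 f 0 0 = za f. Proof. by rewrite mxE. Qed.

Lemma trace1_1 f : trace1 f 1 0 = - zb f. Proof. by rewrite mxE. Qed.

Lemma trace2_0 f : trace2 f 0 0 = ya f. Proof. by rewrite mxE. Qed.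

Lemma trace2_1 f : trace2 f 1 0 = yb f. Proof. by rewrite mxE. Qed.

Let traceE := (trace1_0, trace1_1, trace2_0, trace2_1).

Let linE (c : C) (x y : 'cV[C]_2) i : (c *: x + y) i 0 = c * x i 0 + y i 0.
Proof. by rewrite [LHS]mxE [X in X + _]mxE. Qed.

Lemma trace1_lin c u v : M u -> M v -> G1 (c *: u + v) = c *: G1 u + G1 v.
Proof.
move=> Mu Mv; apply: cV2P; rewrite linE !traceE ?zalin ?zblin//.
by rewrite opprD mulrN.
Qed.

Lemma trace2_lin c u v : M u -> M v -> G2 (c *: u + v) = c *: G2 u + G2 v.
Proof. by move=> Mu Mv; apply: cV2P; rewrite linE !traceE ?yalin ?yblin. Qed.

Lemma trace_green u v : M u -> M v ->
  L2dot u.2 v.1 - L2dot u.1 v.2 = cdot (G1 u) (G2 v) - cdot (G2 u) (G1 v).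
Proof.
move=> Mu Mv; rewrite Mgreen// /cdot !traceE.
have -> : (- zb v.1)^*%C = - (zb v.1)^*%C :> C by case: (zb v.1).
by ring.
Qed.

Let ex_pair f c d : exists u, [/\ M u, u.2 = f, ya u.1 = c & za u.1 = d].
Proof. by have [u [Mu h1 h2]] := Mex f c d; exists (u, f). Qed.

Let tr0 (t : H -> C) : (forall (c : C) u v, M u -> M v ->
  t (c *: u + v).1 = c * t u.1 + t v.1) -> t (0 : H * H).1 = 0.
Proof.
move=> tlin; have := tlin 1 0 0 M0 M0; rewrite mul1r => h.
apply: (addrI (t (0 : H * H).1)); rewrite addr0 -h.
by congr (t _); rewrite scale1r addr0.
Qed.

(* Solutions vanishing to first order at a, with right-hand side in ker l, reach
   every boundary value at b: if w is one with zero data at b then, by Green's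
   identity, w.2 is orthogonal to ker l, hence w.2 = 0. *)
Lemma boundary_control (c d : C) : exists w phi, [/\ M w, M phi, phi.2 = 0, w.2 = phi.1 &
  [/\ ya w.1 = 0, za w.1 = 0, yb w.1 = c & zb w.1 = d]].
Proof.
have [f0 [Mf0 f02 f0a f0a']] := ex_pair 0 1 0.
have [f1 [Mf1 f12 f1a f1a']] := ex_pair 0 0 1.
have [w0 [Mw0 w02 w0a w0a']] := ex_pair f0.1 0 0.
have [w1 [Mw1 w12 w1a w1a']] := ex_pair f1.1 0 0.
pose W (x y : C) := x *: w0 + (y *: w1 + 0).
pose F (x y : C) := x *: f0 + (y *: f1 + 0).
have M1 y : M (y *: w1 + 0) by exact: Mlin y _ _ Mw1 M0.
have M2 y : M (y *: f1 + 0) by exact: Mlin y _ _ Mf1 M0.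
have MW x y : M (W x y) by exact: Mlin x _ _ Mw0 (M1 y).
have MF x y : M (F x y) by exact: Mlin x _ _ Mf0 (M2 y).
have WE (t : H -> C) : (forall (c : C) u v, M u -> M v ->
    t (c *: u + v).1 = c * t u.1 + t v.1) ->
    forall x y, t (W x y).1 = x * t w0.1 + y * t w1.1.
  move=> tlin x y; rewrite /W (tlin _ _ _ Mw0 (M1 y)) (tlin _ _ _ Mw1 M0).
  by rewrite (tr0 tlin) addr0.
have FE (t : H -> C) : (forall (c : C) u v, M u -> M v ->
    t (c *: u + v).1 = c * t u.1 + t v.1) ->
    forall x y, t (F x y).1 = x * t f0.1 + y * t f1.1.
  move=> tlin x y; rewrite /F (tlin _ _ _ Mf0 (M2 y)) (tlin _ _ _ Mf1 M0).
  by rewrite (tr0 tlin) addr0.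
have F2 x y : (F x y).2 = 0.
  rewrite -[LHS]/(x *: f0.2 + (y *: f1.2 + 0)) f02 f12.
  by rewrite !scaler0 !addr0.
have WF x y : (W x y).2 = (F x y).1.
  rewrite -[LHS]/(x *: w0.2 + (y *: w1.2 + 0)) -[RHS]/(x *: f0.1 + (y *: f1.1 + 0)).
  by rewrite w02 w12.
have Wa x y : ya (W x y).1 = 0 by rewrite (WE _ yalin) w0a w1a !mulr0 addr0.
have Wa' x y : za (W x y).1 = 0 by rewrite (WE _ zalin) w0a' w1a' !mulr0 addr0.
have ker x y : yb (W x y).1 = 0 -> zb (W x y).1 = 0 -> x = 0 /\ y = 0.
  move=> b0 b1; have := Mgreen (MW x y) (MF x y).
  rewrite Wa Wa' b0 b1 F2 L2dot0r WF !mul0r !subr0 => /L2_dot_self_eq0 Fz.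
  split.
    have := FE _ yalin x y; rewrite Fz -[X in ya X]/((0 : H * H).1) (tr0 yalin).
    by rewrite f0a f1a mulr1 mulr0 addr0.
  have := FE _ zalin x y; rewrite Fz -[X in za X]/((0 : H * H).1) (tr0 zalin).
  by rewrite f0a' f1a' mulr1 mulr0 add0r.
have {ker} := ker; have := WE _ yblin; have := WE _ zblin.
set d00 := yb w0.1; set d01 := zb w0.1; set d10 := yb w1.1; set d11 := zb w1.1.
move=> Wz Wy ker.
have kerd x y : x * d00 + y * d10 = 0 -> x * d01 + y * d11 = 0 -> x = 0 /\ y = 0.
  by move=> h0 h1; apply: ker; rewrite ?Wz ?Wy.
have det0 : d00 * d11 - d01 * d10 != 0.
  apply/eqP => det.
  (* If the determinant vanishes, (d10, - d00) and (d11, - d01) are in the kernel, so all four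
     entries are 0; but then (1, 0) is in the kernel as well. *)
  have e1 : d10 * d00 + - d00 * d10 = 0 by ring.
  have e2 : d10 * d01 + - d00 * d11 = 0.
    by rewrite -[RHS]oppr0 -det; ring.
  have [d10z /eqP] := kerd _ _ e1 e2; rewrite oppr_eq0 => /eqP d00z.
  have e3 : d11 * d00 + - d01 * d10 = 0 by rewrite -det; ring.
  have e4 : d11 * d01 + - d01 * d11 = 0 by ring.
  have [d11z /eqP] := kerd _ _ e3 e4; rewrite oppr_eq0 => /eqP d01z.
  have e5 : 1 * d00 + 0 * d10 = 0 by rewrite d00z mulr0 mul0r addr0.
  have e6 : 1 * d01 + 0 * d11 = 0 by rewrite d01z mulr0 mul0r addr0.
  by have [/eqP] := kerd _ _ e5 e6; rewrite oner_eq0.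
pose D := d00 * d11 - d01 * d10.
pose x := (c * d11 - d * d10) / D; pose y := (d00 * d - d01 * c) / D.
exists (W x y), (F x y); split=> //; split=> //.
  by rewrite Wy /x /y /D; field.
by rewrite Wz /x /y /D; field.
Qed.

(** A solution of the homogeneous equation takes the data at a; [boundary_control] then corrects the
    data at b without disturbing a. *)
Lemma trace_surjective (g1 g2 : 'cV[C]_2) : exists u, [/\ M u, G1 u = g1 & G2 u = g2].
Proof.
have [v [Mv _ va va']] := ex_pair 0 (g2 0 0) (g1 0 0).
have [w [_ [Mw _ _ _ [wa wa' wb wb']]]] :=
  boundary_control (g2 1 0 - yb v.1) (- g1 1 0 - zb v.1).
exists (1 *: v + w); split; first exact: Mlin.
  apply: cV2P; rewrite traceE ?zalin ?zblin// ?va' ?wa' ?wb' mul1r ?addr0//.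
  by rewrite addrC subrK opprK.
apply: cV2P; rewrite traceE ?yalin ?yblin// ?va ?wa ?wb mul1r ?addr0//.
by rewrite addrC subrK.
Qed.

Definition kernel_restriction : set (H * H) := [set u | [/\ M u, G1 u = 0 & G2 u = 0]].

Local Notation Mmin := kernel_restriction.

Lemma kernel_restriction_green u v : Mmin u -> M v -> L2dot u.2 v.1 = L2dot u.1 v.2.
Proof.
move=> [Mu g1 g2] Mv; apply/eqP; rewrite -subr_eq0 trace_green//.
by rewrite g1 g2 !cdot0l subr0.
Qed.

Lemma kernel_restriction_lin c u v : Mmin u -> Mmin v -> Mmin (c *: u + v).
Proof.
move=> [Mu u1 u2] [Mv v1 v2]; split; first exact: Mlin.
  by rewrite trace1_lin// u1 v1 scaler0 addr0.
by rewrite trace2_lin// u2 v2 scaler0 addr0.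
Qed.

Lemma kernel_restriction0 : Mmin 0.
Proof.
by split=> //; apply: cV2P;
  rewrite traceE ?(tr0 yalin) ?(tr0 yblin) ?(tr0 zalin) ?(tr0 zblin) mxE// oppr0.
Qed.

(** Subtracting a solution z of l z = g leaves r = w - z orthogonal to the range of [Mmin]. Solve l
    s = r from zero data at a and remove the data of s at b by t, where l t = phi lies in ker l:
    then s - t is in [Mmin] with image r - phi. That image is orthogonal to r, and to phi by Green's
    identity, so r = phi and w = phi + z. *)
Lemma kernel_restriction_adjoint_sub v : adjoint Mmin v -> M v.
Proof.
case: v => w g vadj; have [z [Mz z2 _ _]] := ex_pair g 0 0.
pose r := w - z.1.
have rorth u : Mmin u -> L2dot u.2 r = 0.
  move=> mu_; have := vadj u mu_; rewrite /r L2dotDr L2dotNr => ->.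
  by rewrite (kernel_restriction_green mu_ Mz) z2 subrr.
have [s [Ms s2 sa sa']] := ex_pair r 0 0.
have [t [phi [Mt Mphi phi2 t2 [ta ta' tb tb']]]] := boundary_control (yb s.1) (zb s.1).
pose u := (-1) *: t + s.
have mu_ : Mmin u.
  split; first exact: Mlin.
    apply: cV2P; rewrite traceE /u ?zalin ?zblin// ?ta' ?sa' ?tb' mxE ?mulr0 ?addr0//.
    by rewrite mulN1r addNr oppr0.
  apply: cV2P; rewrite traceE /u ?yalin ?yblin// ?ta ?sa ?tb mxE ?mulr0 ?addr0//.
  by rewrite mulN1r addNr.
have u2 : u.2 = r - phi.1.
  by rewrite -[LHS]/((-1) *: t.2 + s.2) s2 t2 scaleN1r addrC.
have rphi : r = phi.1.
  apply/eqP; rewrite -subr_eq0; apply/eqP; apply: L2_dot_self_eq0.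
  rewrite -u2 [X in L2dot _ X]u2 L2dotDr L2dotNr rorth//.
  by rewrite (kernel_restriction_green mu_ Mphi) phi2 L2dot0r subr0.
have -> : (w, g) = 1 *: phi + z.
  rewrite [RHS]surjective_pairing; congr (_, _).
    by rewrite -[RHS]/(1 *: phi.1 + z.1) scale1r -rphi /r subrK.
  by rewrite -[RHS]/(1 *: phi.2 + z.2) phi2 scaler0 add0r z2.
exact: Mlin.
Qed.

(** Orthogonality of h to the domain says precisely that (0, h) is in the adjoint, hence in M, where
    0 has the single image 0. *)
Lemma kernel_restriction_dense : densely_defined Mmin.
Proof.
move=> f e e0.
have D0 : [set u.1 | u in Mmin] 0 by exists 0 => //; exact: kernel_restriction0.
have Dlin (c : C) (x y : H) : [set u.1 | u in Mmin] x -> [set u.1 | u in Mmin] y ->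
    [set u.1 | u in Mmin] (c *: x + y).
  move=> [u mu_ <-] [v mv <-]; exists (c *: u + v) => //.
  exact: kernel_restriction_lin.
have Dorth h : (forall x, [set u.1 | u in Mmin] x -> L2dot h x = 0) -> h = 0.
  move=> horth; have hadj : adjoint Mmin (0, h).
    move=> u mu_; rewrite -[(0, h).1]/(0 : H) L2dot0r -[(0, h).2]/h L2dotC.
    by rewrite horth ?/= ?oppr0//; exists u.
  exact: Mfun (kernel_restriction_adjoint_sub hadj) M0.
have [_ [u mu_ <-] ue] := L2_dense_of_orthogonal D0 Dlin Dorth f e0.
by exists u.
Qed.

(* In these coordinates the boundary condition reads gm = K gp and Green's form
   is a multiple of <gp, gp'> - <gm, gm'>. *)
Let gp u : 'cV[C]_2 := G1 u + 'i%C *: G2 u.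
Let gm u : 'cV[C]_2 := G1 u - 'i%C *: G2 u.

Let conj_i : ('i%C)^*%C = - 'i%C :> C.
Proof. by apply/eqP; rewrite eq_complex /= oppr0 !eqxx. Qed.

Let conj_Ni : (- 'i%C)^*%C = 'i%C :> C.
Proof. by apply/eqP; rewrite eq_complex /= !oppr0 opprK !eqxx. Qed.

Let i_neq0 : 'i%C != 0 :> C.
Proof. by apply/eqP => -[/eqP]; rewrite oner_eq0. Qed.

Let gpE u i : gp u i 0 = 'i%C * G2 u i 0 + G1 u i 0.
Proof. by rewrite /gp addrC linE. Qed.

Let gmE u i : gm u i 0 = (- 'i%C) * G2 u i 0 + G1 u i 0.
Proof. by rewrite /gm addrC -scaleNr linE. Qed.

Let form_gpm u v : cdot (gp u) (gp v) - cdot (gm u) (gm v) =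
  -2 * 'i%C * (cdot (G1 u) (G2 v) - cdot (G2 u) (G1 v)).
Proof.
have cgp k : (gp v k 0)^*%C = - 'i%C * (G2 v k 0)^*%C + (G1 v k 0)^*%C.
  by rewrite gpE conjcD conjcM conj_i.
have cgm k : (gm v k 0)^*%C = 'i%C * (G2 v k 0)^*%C + (G1 v k 0)^*%C.
  by rewrite gmE conjcD conjcM conj_Ni.
rewrite /cdot (cgp 0) (cgp 1) (cgm 0) (cgm 1).
rewrite (gpE u 0) (gpE u 1) (gmE u 0) (gmE u 1).
move: (G1 u 0 0) (G1 u 1 0) (G2 u 0 0) (G2 u 1 0).
move: ((G1 v 0 0)^*%C) ((G1 v 1 0)^*%C) ((G2 v 0 0)^*%C) ((G2 v 1 0)^*%C).
by move=> *; ring.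
Qed.

Let green_gpm u v : M u -> M v ->
  (cdot (gp u) (gp v) = cdot (gm u) (gm v) <-> L2dot u.2 v.1 = L2dot u.1 v.2).
Proof.
move=> Mu Mv; split=> /eqP; rewrite -subr_eq0 => /eqP h; apply/eqP; rewrite -subr_eq0.
  rewrite trace_green//; move: h; rewrite form_gpm => /eqP.
  by rewrite !mulf_eq0 oppr_eq0 pnatr_eq0 (negbTE i_neq0).
by rewrite form_gpm -trace_green// h mulr0.
Qed.

Let gpm_surj x y : exists u, [/\ M u, gp u = x & gm u = y].
Proof.
have [u [Mu g1 g2]] := trace_surjective (2^-1 *: (x + y)) ((2 * 'i%C)^-1 *: (x - y)).
exists u; split=> //; apply: cV2P; rewrite ?gpE ?gmE g1 g2 !mxE; field;
  by rewrite ?i_neq0.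
Qed.

Let gp_lin c u v : M u -> M v -> gp (c *: u + v) = c *: gp u + gp v.
Proof.
move=> Mu Mv; have E i : gp (c *: u + v) i 0 = (c *: gp u + gp v) i 0.
  rewrite (gpE (c *: u + v)) (trace1_lin c Mu Mv) (trace2_lin c Mu Mv).
  rewrite (linE c (G1 u) (G1 v)) (linE c (G2 u) (G2 v)) (linE c (gp u) (gp v)).
  rewrite (gpE u) (gpE v).
  by move: (G1 u i 0) (G1 v i 0) (G2 u i 0) (G2 v i 0) => *; ring.
by apply: cV2P; exact: E.
Qed.

Let gm_lin c u v : M u -> M v -> gm (c *: u + v) = c *: gm u + gm v.
Proof.
move=> Mu Mv; have E i : gm (c *: u + v) i 0 = (c *: gm u + gm v) i 0.
  rewrite (gmE (c *: u + v)) (trace1_lin c Mu Mv) (trace2_lin c Mu Mv).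
  rewrite (linE c (G1 u) (G1 v)) (linE c (G2 u) (G2 v)) (linE c (gm u) (gm v)).
  rewrite (gmE u) (gmE v).
  by move: (G1 u i 0) (G1 v i 0) (G2 u i 0) (G2 v i 0) => *; ring.
by apply: cV2P; exact: E.
Qed.

Let trace_gpm u : gp u = 0 -> gm u = 0 -> G1 u = 0 /\ G2 u = 0.
Proof.
move=> hp hm; have e k : G1 u k 0 = 0 /\ G2 u k 0 = 0.
  have z0 : (0 : 'cV[C]_2) k 0 = 0 by rewrite mxE.
  have := gpE u k; have := gmE u k; rewrite hp hm z0.
  move: (G1 u k 0) (G2 u k 0) => s t e1 e2.
  have : 2 * 'i%C * t = ('i%C * t + s) - (- 'i%C * t + s) by ring.
  rewrite -e1 -e2 subrr => /eqP; rewrite !mulf_eq0 pnatr_eq0 (negbTE i_neq0) /=.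
  by move=> /eqP t0; move: e2; rewrite t0 mulr0 add0r.
have [e00 e01] := e 0; have [e10 e11] := e 1.
by split; apply: cV2P; rewrite [RHS]mxE.
Qed.

Definition boundary_restriction (K : 'M[C]_2) : set (H * H) :=
  [set u | M u /\ (K - 1%:M) *m G1 u + 'i%C *: ((K + 1%:M) *m G2 u) = 0].

Let boundary_restrictionP K u :
  boundary_restriction K u <-> M u /\ gm u = K *m gp u.
Proof.
have E : (K - 1%:M) *m G1 u + 'i%C *: ((K + 1%:M) *m G2 u) = K *m gp u - gm u.
  rewrite /gp /gm mulmxBl mulmxDl !mul1mx mulmxDr -scalemxAr scalerDr.
  by rewrite addrACA opprB [- _ + _]addrC.
rewrite /boundary_restriction /= E; split=> -[Mu h]; split=> //.
  by apply/esym/eqP; rewrite -subr_eq0 h.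
by rewrite h subrr.
Qed.

Lemma adjoint_restriction_sub L v : Mmin `<=` L -> adjoint L v -> M v.
Proof.
by move=> ML vL; apply: kernel_restriction_adjoint_sub => u /ML; exact: vL.
Qed.

Lemma dense_restriction L : Mmin `<=` L -> densely_defined L.
Proof.
move=> ML f e /(kernel_restriction_dense f)[u /ML Lu ue].
by exists u.
Qed.

Lemma boundary_restriction_self_adjoint K : K \is unitarymx ->
  self_adjoint_extension Mmin (boundary_restriction K).
Proof.
move=> uK; have sub : Mmin `<=` boundary_restriction K.
  move=> u [Mu u1 u2]; split=> //.
  by rewrite u1 u2 !mulmx0 scaler0 addr0.
split; first exact: sub.
split.
- split.
  + exact/sub/kernel_restriction0.
  + move=> c u v /boundary_restrictionP[Mu hu] /boundary_restrictionP[Mv hv].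
    apply/boundary_restrictionP; split; first exact: Mlin.
    rewrite (gp_lin c Mu Mv) (gm_lin c Mu Mv) hu hv [RHS]mulmxDr.
    by congr (_ + _); exact: scalemxAr.
  + by move=> f g h [Mg _] [Mh _]; exact: Mfun Mg Mh.
- exact: dense_restriction.
apply/seteqP; split=> v.
  move=> vadj; have Mv := adjoint_restriction_sub sub vadj.
  apply/boundary_restrictionP; split=> //; apply: cdot_eq => y.
  (* Every y occurs as [gm u] for an element of the restriction, namely with [gp u] the image of y
     under [adjointmx K]; testing against all of these forces gm v = K (gp v). *)
  have [u [Mu up um]] := gpm_surj (adjointmx K *m y) y.
  have KK : K *m adjointmx K = 1%:M by exact/unitarymxP.
  have uL : boundary_restriction K u.
    by apply/boundary_restrictionP; split=> //; rewrite up um mulmxA KK mul1mx.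
  have /(green_gpm Mu Mv) := vadj u uL; rewrite up um => <-.
  by rewrite -(unitary_cdot _ _ uK) mulmxA KK mul1mx.
move=> /boundary_restrictionP[Mv hv] u /boundary_restrictionP[Mu hu].
by apply/(green_gpm Mu Mv); rewrite hu hv unitary_cdot.
Qed.

(** L lies between [Mmin] and M, so it is the full preimage of its set S of boundary values;
    self-adjointness of L says that S is its own annihilator. *)
Lemma self_adjoint_boundary_restriction L : self_adjoint_extension Mmin L ->
  exists2 K, K \is unitarymx & L = boundary_restriction K.
Proof.
move=> [ML [[L0 Llin _] _ Ladj]].
have LM : L `<=` M by move=> u; rewrite -Ladj; exact: adjoint_restriction_sub.
pose S : set ('cV[C]_2 * 'cV[C]_2) := [set (gp u, gm u) | u in L].
have in_L u u' : L u -> M u' -> gp u' = gp u -> gm u' = gm u -> L u'.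
  move=> Lu Mu' hp hm; have Mu := LM _ Lu.
  have [t1 t2] : G1 ((-1) *: u + u') = 0 /\ G2 ((-1) *: u + u') = 0.
    apply: trace_gpm; first by rewrite (gp_lin _ Mu Mu') hp scaleN1r addNr.
    by rewrite (gm_lin _ Mu Mu') hm scaleN1r addNr.
  have Ld : L ((-1) *: u + u').
    by apply: ML; split; [exact: Mlin _ Mu Mu'|exact: t1|exact: t2].
  have := Llin 1 _ _ Lu Ld; congr L.
  by rewrite scale1r scaleN1r addrA subrr add0r.
have S0 : S 0.
  exists 0 => //; have := gp_lin (-1) M0 M0; have := gm_lin (-1) M0 M0.
  by rewrite !scaleN1r !addNr => -> ->.
have Slin (c : C) (x y : 'cV[C]_2 * 'cV[C]_2) : S x -> S y -> S (c *: x + y).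
  move=> [u Lu <-] [v Lv <-]; exists (c *: u + v); first exact: Llin.
  by rewrite gp_lin ?gm_lin//; exact: LM.
have [|K uK SK] := selforthogonal_graph_unitary S0 Slin.
  move=> x; split=> [[v Lv <-] _ [u Lu <-]|xorth].
    apply/(green_gpm (LM _ Lu) (LM _ Lv)).
    have aL : adjoint L v by rewrite Ladj.
    exact: aL.
  (* Surjectivity lifts the annihilating pair x to some v in M; Green's identity puts v in the
     adjoint of L, that is, in L. *)
  have [v [Mv vp vm]] := gpm_surj x.1 x.2.
  exists v; last by rewrite vp vm -surjective_pairing.
  rewrite -Ladj => u Lu; apply/(green_gpm (LM _ Lu) Mv); rewrite vp vm.
  by apply: (xorth (gp u, gm u)); exists u.
exists K => //; apply/seteqP; split=> u.
  move=> Lu; apply/boundary_restrictionP; split; first exact: LM.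
  by apply: (SK (gp u, gm u)).1; exists u.
move=> /boundary_restrictionP[Mu hu].
have [v Lv [vp vm]] := (SK (gp u, gm u)).2 hu.
exact: in_L Lv Mu (esym vp) (esym vm).
Qed.

(** Since the boundary values fill the whole space, every pair (x, K x) is realized in the
    restriction, and the restriction determines the graph of K. *)
Lemma boundary_restriction_inj : injective boundary_restriction.
Proof.
move=> K K' KK'; have E (x : 'cV[C]_2) : K *m x = K' *m x.
  have [u [Mu up um]] := gpm_surj x (K *m x).
  have : boundary_restriction K u.
    by apply/boundary_restrictionP; split; [exact: Mu|rewrite up um].
  by rewrite KK' => /boundary_restrictionP[_]; rewrite up um.
apply/matrixP => i j; have := E (delta_mx j 0).
by rewrite -!colE => /matrixP/(_ i 0); rewrite !mxE.
Qed.

End boundary_triple.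

(** * The boundary triple of [Lmax] *)

Theorem theorem4 (R : realType) (a b : R) (p Q : R -> R)
    (ab : a < b)
    (mp : lebesgue_measurable_fun a b p)
    (mQ : lebesgue_measurable_fun a b Q)
    (p0 : \forall x \ae (@lebesgue_measure R), (`]a, b[%classic : set R) x -> p x != 0)
    (ip : in_L1 a b (fun x => 1 / p x))
    (iQp : in_L1 a b (fun x => Q x / p x))
    (iQ2p : in_L1 a b (fun x => Q x ^+ 2 / p x)) :
  [/\ forall K : 'M[R[i]]_2, K \is unitarymx ->
        self_adjoint_extension (Lmin p Q) (@LK R a b p Q K),
      forall L : set (L2 a b * L2 a b), self_adjoint_extension (Lmin p Q) L ->
        exists2 K : 'M[R[i]]_2, K \is unitarymx & L = LK p Q K &
      set_bij [set K : 'M[R[i]]_2 | K \is unitarymx]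
        [set L | self_adjoint_extension (Lmin p Q) L]
        (@LK R a b p Q)].
Proof.
have [be ibe beE] := ip; have [al ial alE] := iQp; have [ga iga gaE] := iQ2p.
have aab : a \in `[a, b] by rewrite in_itv /= lexx ltW.
have bab : b \in `[a, b] by rewrite in_itv /= lexx ltW.
pose M : set (L2 a b * L2 a b) := Lmax p Q.
have lin := Lmax_lin ab p0 ibe ial iga beE alE gaE.
have M0 : M 0 := Lmax0 ab p0 ibe ial iga beE alE gaE.
have Mlin (c : R[i]) (u v : L2 a b * L2 a b) : M u -> M v -> M (c *: u + v).
  by move=> Mu Mv; have [] := lin c u v Mu Mv.
have D0 x : x \in `[a, b] -> forall (c : R[i]) (u v : L2 a b * L2 a b), M u -> M v ->
    qD0 (c *: u + v).1 x = c * qD0 u.1 x + qD0 v.1 x.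
  by move=> xab c u v Mu Mv; have [_ + _] := lin c u v Mu Mv; exact.
have D1 x : x \in `[a, b] -> forall (c : R[i]) (u v : L2 a b * L2 a b), M u -> M v ->
    qD1 p Q (c *: u + v).1 x = c * qD1 p Q u.1 x + qD1 p Q v.1 x.
  by move=> xab c u v Mu Mv; have [_ _ +] := lin c u v Mu Mv; exact.
have green := Lmax_green ab p0 ibe ial iga beE alE gaE.
have ex := Lmax_exists ab p0 ibe ial iga beE alE gaE.
have fn := @Lmax_functional R a b p Q.
pose za (f : L2 a b) := qD1 p Q f a; pose zb (f : L2 a b) := qD1 p Q f b.
pose ya (f : L2 a b) := qD0 f a; pose yb (f : L2 a b) := qD0 f b.
have LminE : Lmin p Q = kernel_restriction M ya yb za zb.
  apply/seteqP; split=> u.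
    move=> [Mu y1 y2 z1 z2]; split=> //; apply: cV2P.
    - by rewrite trace1_0 /za z1 mxE.
    - by rewrite trace1_1 /zb z2 mxE oppr0.
    - by rewrite trace2_0 /ya y1 mxE.
    - by rewrite trace2_1 /yb y2 mxE.
  move=> [Mu g1 g2]; split=> //.
  - by rewrite -[LHS]/(ya u.1) -(trace2_0 ya yb) g2 mxE.
  - by rewrite -[LHS]/(yb u.1) -(trace2_1 ya yb) g2 mxE.
  - by rewrite -[LHS]/(za u.1) -(trace1_0 za zb) g1 mxE.
  - apply/eqP; rewrite -oppr_eq0; apply/eqP.
    by rewrite -[qD1 _ _ _ _]/(zb u.1) -(trace1_1 za zb) g1 mxE.
have LKE : LK p Q = boundary_restriction M ya yb za zb by [].
have sa K : K \is unitarymx -> self_adjoint_extension (Lmin p Q) (@LK R a b p Q K).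
  rewrite LminE LKE; apply: boundary_restriction_self_adjoint => //;
    by [exact: D0|exact: D1|exact: green|exact: ex].
have as_ (L : set (L2 a b * L2 a b)) : self_adjoint_extension (Lmin p Q) L ->
    exists2 K : 'M[R[i]]_2, K \is unitarymx & L = LK p Q K.
  rewrite LminE LKE; apply: self_adjoint_boundary_restriction => //;
    by [exact: D0|exact: D1|exact: green|exact: ex].
split=> //; split.
- by move=> K; exact: sa.
- rewrite LKE => K K' _ _; apply: (boundary_restriction_inj _ _ _ _ _ _ green ex) => //;
    by [exact: D0|exact: D1].
- by move=> L /as_[K uK LE]; exists K.
Qed.
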